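(* There exists a universal constant $K>0$ such that for all connected weighted graphs $G=(V,E,\{w_e\}_{e\in E})$, all $\varepsilon\in(0,1/2)$ and all integers $k$ with $1\leq k\leq |V|/2$, $$\mathsf{T}_{\mathrm{IP}(k,G)}(\varepsilon)\;\leq\; K\;\mathsf{T}_{\mathrm{IP}(2,G)}(1/4)\;\ln(|V|/\varepsilon).$$
   Context: A weighted graph is a triple $G=(V,E,\{w_e\}_{e\in E})$ where $V$ is a finite nonempty set, $E$ is a set of two-element subsets of $V$, and $w_e>0$ for each $e\in E$. For $e=\{a,b\}\in E$ let $f_e:V\to V$ be the transposition exchanging $a$ and $b$ and fixing all other vertices. $(V)_k$ is the set of $k$-tuples $\mathbf{x}=(\mathbf{x}(1),\ldots,\mathbf{x}(k))$ of distinct elements of $V$, and $f_e(\mathbf{x})=(f_e(\mathbf{x}(i)))_{i=1}^k$. $\mathrm{IP}(k,G)$ (the $k$-particle interchange process) is the continuous-time Markov chain on $(V)_k$ in which, for each $e\in E$, the state $\mathbf{x}$ is replaced by $f_e(\mathbf{x})$ at rate $w_e$; i.e. for $\mathbf{x}\neq\mathbf{y}$ the transition rate is $w_e$ if $f_e(\mathbf{x})=\mathbf{y}$ for some $e\in E$, and $0$ otherwise. The total variation distance between probability measures on a finite set $S$ is $d_{\mathrm{TV}}(\mu,\nu)=\max_{A\subset S}(\mu(A)-\nu(A))$. For an irreducible continuous-time Markov chain $Q$ on a finite set $S$ with transition probabilities $q_t(s,s')$ and stationary distribution $\pi$, the $\varepsilon$-mixing time is $\mathsf{T}_Q(\varepsilon)=\inf\{t\geq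 0:\max_{s\in S}d_{\mathrm{TV}}(q_t(s,\cdot),\pi)\leq\varepsilon\}$. *)

(* Defs.v *)
From HB Require Import structures.
From mathcomp Require Import all_boot all_order all_algebra all_fingroup.
From mathcomp Require Import all_classical all_reals all_analysis.

Set Implicit Arguments.
Unset Strict Implicit.
Unset Printing Implicit Defensive.

Import Order.TTheory GRing.Theory Num.Theory.
Import numFieldNormedType.Exports.
Local Open Scope classical_set_scope.
Local Open Scope ring_scope.

Section FiniteChain.
Variables (R : realType) (S : finType).

Definition dTV (mu nu : S -> R) : R :=
  \big[Num.max/0]_(A : {set S}) (\sum_(s in A) mu s - \sum_(s in A) nu s).
(* The default 0 of this maximum is the value at A = set0. *)

Definition expmx n (A : 'M[R]_n) : 'M[R]_n :=
  \matrix_(i, j) limn (series (fun m : nat => (A ^+ m) i j / m`!%:R)).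

(* A chain is given by its jump rates rate s s' for s != s'; the values
   rate s s are not used. *)
Variable rate : S -> S -> R.

Definition generator : 'M[R]_#|S| :=
  \matrix_(i, j) if i == j then - \sum_(s | s != enum_val i) rate (enum_val i) s
                 else rate (enum_val i) (enum_val j).

Definition transition (t : R) (s s' : S) : R :=
  expmx (t *: generator) (enum_rank s) (enum_rank s').

Definition is_stationary (p : S -> R) : Prop :=
  [/\ forall s, 0 <= p s, \sum_s p s = 1 &
      forall t, 0 <= t -> forall s', \sum_s p s * transition t s s' = p s'].

(* For an irreducible chain exactly one distribution is stationary; the default
   value is irrelevant then. *)
Definition stationary_dist : S -> R := xget (fun=> 0) [set p | is_stationary p].

(* Infimum in the extended reals, so that the empty set gives +oo. *)
Definition mixing_time (eps : R) : \bar R :=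
  ereal_inf [set t%:E | t in
    [set t : R | 0 <= t /\
      \big[Num.max/0]_(s : S) dTV (transition t s) stationary_dist <= eps]].

End FiniteChain.

Record weighted_graph (R : realType) := WeightedGraph {
  vertex :> finType;
  edges : {set {set vertex}};
  (* only the values on edges are meaningful *)
  weight : {set vertex} -> R;
  vertex_nonempty : (0 < #|vertex|)%N;
  edges_card2 : forall e, e \in edges -> #|e| = 2%N;
  weight_gt0 : forall e, e \in edges -> 0 < weight e }.

Definition adjacent (R : realType) (G : weighted_graph R) : rel G :=
  fun a b => [set a; b]%SET \in edges G.

Definition connected_graph (R : realType) (G : weighted_graph R) : Prop :=
  forall a b : G, connect (@adjacent R G) a b.

Definition edge_swap (V : finType) (e : {set V}) : {perm V} :=
  if [pick p : V * V | e == [set p.1; p.2]%SET] is Some p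
  then tperm p.1 p.2 else 1%g.

Lemma edge_swapE (V : finType) (a b : V) : edge_swap [set a; b]%SET = tperm a b.
Proof.
rewrite /edge_swap; case: pickP => [[c d] /= /eqP E|/(_ (a, b))]; last first.
  by rewrite /= eqxx.
have := set21 c d; have := set22 c d; have := set21 a b; have := set22 a b.
rewrite {1 2}E -{3 4}E !inE.
by do 4![case/orP => /eqP ?]; subst; rewrite // tpermC.
Qed.

Definition config (V : finType) (k : nat) : finType :=
  {x : k.-tuple V | uniq x}.

Section Interchange.
Variables (V : finType) (k : nat).

Lemma perm_config_subproof (f : {perm V}) (x : config V k) :
  uniq (map_tuple f (val x)).
Proof. by rewrite map_inj_uniq ?(valP x) //; exact: perm_inj. Qed.

Definition perm_config (f : {perm V}) (x : config V k) : config V k :=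
  exist _ (map_tuple f (val x)) (perm_config_subproof f x).

End Interchange.

Section InterchangeProcess.
Variables (R : realType) (G : weighted_graph R) (k : nat).

Definition ip_rate (x y : config G k) : R :=
  \sum_(e in edges G | perm_config (edge_swap e) x == y) weight e.

(* Distinct edges never produce the same jump x -> y <> x. *)
Lemma ip_rateE (x y : config G k) (e : {set G}) :
  x != y -> e \in edges G -> perm_config (edge_swap e) x = y ->
  ip_rate x y = weight e.
Proof.
move=> xy eE exy; rewrite /ip_rate (bigD1 e) ?eE ?exy ?eqxx //= big1 ?addr0 //.
suff key e1 e2 : e1 \in edges G -> e2 \in edges G ->
    perm_config (edge_swap e1) x = y -> perm_config (edge_swap e2) x = y ->
    e1 = e2.
  by move=> e' /andP[/andP[e'E /eqP /key]] /(_ e e'E eE) H /eqP[]; apply: H.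
have [i xi] : exists i, tnth (val x) i != tnth (val y) i.
  apply/existsP; apply: contraNT xy => /existsPn h; apply/eqP/val_inj.
  by apply: eq_from_tnth => i; apply/eqP; have := h i; rewrite negbK.
have swapi e0 : e0 \in edges G -> perm_config (edge_swap e0) x = y ->
    e0 = [set tnth (val x) i; tnth (val y) i]%SET.
  move=> /edges_card2 /eqP /cards2P [a [b [ab ->]]] h.
  have : tnth (val y) i = tperm a b (tnth (val x) i).
    by rewrite -h /= tnth_map edge_swapE.
  case: tpermP => [-> ->|-> ->|_ _ h']; rewrite 1?finset.setUC //.
  by move: xi; rewrite h' eqxx.
by move=> E1 E2 /(swapi _ E1) -> /(swapi _ E2).
Qed.

Definition ip_mixing_time (eps : R) : \bar R := mixing_time ip_rate eps.

End InterchangeProcess.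

(* Main.v *)
Require Import Defs.
From HB Require Import structures.
From mathcomp Require Import all_boot all_order all_algebra all_fingroup.
From mathcomp Require Import all_classical all_reals all_analysis.
From mathcomp Require Import ring lra zify.

(* Split the k particles into k - 1 black ones, with positions z, and a last
   one, and follow a signed measure f of total mass 0, supported off z, for the
   position of the last one.  One round lasts 3t, where t mixes two particles.
   During the first 2t all particles just move; by then every pair of particles
   has probability at least 1/(3 n^2) of occupying any given pair of vertices.
   During the last t the particles are greedily matched as they meet: when an
   edge whose two ends are unmatched rings, these two particles get matched,
   and if neither is black the coin deciding whether they swap is averaged out,
   which lowers the squared L2 norm of f by half the square of its jump along
   the edge.  Unmatched particles still carry their original values of f, the
   expected number of matches is at least n/36, and n - k + 1 >= n/2, so each
   round multiplies the expected squared norm by at most 1 - 1/216.  Moving one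
   particle at a time, 2k such comparisons join any two configurations.

   All of this takes place in discrete time: exp(tQ) is the limit of
   (1 + (t/N) Q)^N, and a step of 1 + hQ lets an edge e ring with probability
   2 h w_e and then swaps its ends according to a fair coin. *)

Set Implicit Arguments.
Unset Strict Implicit.
Unset Printing Implicit Defensive.

Import Order.TTheory GRing.Theory Num.Theory.
Import numFieldNormedType.Exports.
Local Open Scope classical_set_scope.
Local Open Scope ring_scope.

(** * Greedy matching of the particles *)

Section Chameleon.
Variables (R : realType) (V : finType).
Implicit Types (s : seq (V * V)) (z : seq V) (f d : V -> R) (h : V -> V -> R).
Implicit Types (M U : {set V}) (p : V * V).

Let tau p : {perm V} := tperm p.1 p.2.

(** A fair coin decides for each pair of [s] in turn whether it is swapped. Products of permutations
    act from left to right, so [tau p] comes first. *)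
Fixpoint coin_mean s (F : {perm V} -> R) : R :=
  if s is p :: s' then
    (coin_mean s' F + coin_mean s' (fun r => F (tau p * r)%g)) / 2
  else F 1%g.

Definition matchable M p := (p.1 \notin M) && (p.2 \notin M).

Definition rematch M p := if matchable M p then [set p.1; p.2]%SET :|: M else M.

(** This is a preimage; for the involutions [tau p], with which [gain] uses it, it is the image as
    well. *)
Definition moved (g : {perm V}) M : {set V} := [set x | g x \in M]%SET.

(* The expected sum of [h] over the pairs of particles that get matched while the
   edges of [s] ring; [M] is the set of vertices holding matched particles, and
   both [h] (a function of the initial positions) and [M] move with them. *)
Fixpoint gain s h M : R :=
  if s is p :: s' then
    (if matchable M p then h p.1 p.2 else 0) +
    (gain s' h (rematch M p) +
     gain s' (fun x y => h (tau p x) (tau p y)) (moved (tau p) (rematch M p))) / 2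
  else 0.

Lemma tauK p : involutive (tau p).
Proof. exact: tpermK. Qed.

Lemma sum_tau p f : \sum_x f (tau p x) = \sum_x f x.
Proof. by rewrite [RHS](reindex_inj (@perm_inj _ (tau p))). Qed.

Lemma tau_out p x : x \notin [set p.1; p.2]%SET -> tau p x = x.
Proof. by rewrite !inE negb_or => /andP[? ?]; rewrite /tau tpermD // eq_sym. Qed.

Lemma card_moved (g : {perm V}) M : #|moved g M| = #|M|.
Proof.
rewrite -(card_imset M (@perm_inj _ g^-1)); congr #|pred_of_set _|.
apply/setP => x; rewrite inE; apply/idP/imsetP => [gx|[y yM ->]].
  by exists (g x) => //; rewrite permK.
by rewrite permKV.
Qed.

Lemma sum_diff_tau p f :
  \sum_x (f x - f (tau p x)) ^+ 2 = 2 * (f p.1 - f p.2) ^+ 2.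
Proof.
case: p => a b /=; rewrite /tau /=; have [<-|ab] := eqVneq a b.
  rewrite big1 => [|x _]; first by ring.
  by rewrite tperm1 perm1; ring.
rewrite (bigD1 a) //= (bigD1 b) 1?eq_sym //= tpermL tpermR big1 => [|x /andP[xa xb]].
  by ring.
by rewrite tpermD 1?eq_sym //; ring.
Qed.

(** By the parallelogram identity the loss is a quarter of the sum of [(f x - f (tau p x)) ^+ 2], to
    which only the two ends of [p] contribute. *)
Lemma sum_average_sqr p f :
  \sum_x ((f x + f (tau p x)) / 2) ^+ 2 =
  \sum_x f x ^+ 2 - (f p.1 - f p.2) ^+ 2 / 2.
Proof.
have H : \sum_x (f x ^+ 2 + f (tau p x) ^+ 2) = 2 * \sum_x f x ^+ 2.
  by rewrite big_split /= (sum_tau p (fun x => f x ^+ 2)); ring.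
have -> : (f p.1 - f p.2) ^+ 2 / 2 = (\sum_x (f x - f (tau p x)) ^+ 2) / 4.
  by rewrite sum_diff_tau; field.
have -> : \sum_x f x ^+ 2 = (\sum_x (f x ^+ 2 + f (tau p x) ^+ 2)) / 2.
  by rewrite H; field.
rewrite !mulr_suml -sumrB; apply: eq_bigr => x _; by field.
Qed.

(** * Decay of the squared norm along a fixed sequence of rings *)

Section SquareBound.
Variables (k : nat) (H : V -> seq V -> R) (C : R).

Definition admissible z f :=
  [/\ uniq z, size z = k, (forall x, x \in z -> f x = 0) & \sum_x f x = 0].

Hypothesis H_bound : forall z f, admissible z f ->
  (\sum_b f b * H b z) ^+ 2 <= C * \sum_b f b ^+ 2.

(** [H] will be an observable averaged over the later rounds, and [H_bound] the contraction already
    obtained for those rounds. *)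
Definition pairing s z f : R :=
  \sum_b f b * coin_mean s (fun r => H (r b) (map r z)).

Lemma coin_mean_ext s (F F' : {perm V} -> R) : F =1 F' -> coin_mean s F = coin_mean s F'.
Proof. by move=> /funext ->. Qed.

(** In the swapped branch, substituting [tau p b] for [b] carries [f] and [z] along with the
    particles. *)
Lemma pairing_cons p s z f :
  pairing (p :: s) z f =
  (pairing s z f + pairing s (map (tau p) z) (fun x => f (tau p x))) / 2.
Proof.
rewrite /pairing /= -[X in (_ + X) / 2](sum_tau p) -big_split mulr_suml.
apply: eq_bigr => b _ /=; rewrite tauK mulrA mulrDr; congr ((_ + _ * _) / 2).
apply: coin_mean_ext => r; rewrite permM; congr H; rewrite -map_comp.
by apply: eq_map => x /=; rewrite permM.
Qed.

Lemma admissible_tau p z f :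
  admissible z f -> admissible (map (tau p) z) (fun x => f (tau p x)).
Proof.
case=> uz sz fz sf; split; rewrite ?size_map ?map_inj_uniq ?sum_tau //.
- exact: perm_inj.
- by move=> _ /mapP[x xz ->]; rewrite tauK fz.
Qed.

(** When neither end is black, [tau p] fixes every entry of [z], so the average still vanishes
    there. *)
Lemma admissible_average p z f : p.1 \notin z -> p.2 \notin z ->
  admissible z f -> admissible z (fun x => (f x + f (tau p x)) / 2).
Proof.
move=> az bz [uz sz fz sf]; split=> //.
- move=> x xz; rewrite tau_out ?fz ?addr0 ?mul0r //.
  by rewrite !inE; apply/norP; split; apply: contraTneq xz => ->.
- by rewrite -mulr_suml big_split /= sum_tau sf addr0 mul0r.
Qed.

(* Nothing is required on [M]: a matched particle is never matched again. *)
Definition colored M z f h := forall a b, a \notin M -> b \notin M ->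
  h a b = if (a \notin z) && (b \notin z) then (f a - f b) ^+ 2 else 0.

Lemma colored_sub M M' z f h : M \subset M' -> colored M z f h -> colored M' z f h.
Proof.
by move=> sub ch a b aM bM; apply: ch; [move: aM | move: bM];
  apply: contra => /(fintype.subsetP sub).
Qed.

Lemma sub_rematch M p : M \subset rematch M p.
Proof. by rewrite /rematch; case: ifP => // _; rewrite finset.subsetUr. Qed.

Lemma colored_tau M z f h p : colored M z f h ->
  colored (moved (tau p) M) (map (tau p) z) (fun x => f (tau p x))
    (fun x y => h (tau p x) (tau p y)).
Proof.
move=> ch a b; rewrite !inE => aM bM; rewrite ch //.
have memt x : (x \in map (tau p) z) = (tau p x \in z).
  by rewrite -{1}[x](tauK p) mem_map //; exact: perm_inj.
by rewrite !memt.
Qed.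

(* When two unmatched non-black particles meet, the coin deciding whether they
   swap is averaged out, which replaces the values of [f] at the two ends by
   their mean; every other coin acts by transport and convexity. *)
Lemma pairing_sqr s M z f h :
  admissible z f -> colored M z f h ->
  pairing s z f ^+ 2 <= C * (\sum_b f b ^+ 2 - gain s h M / 2).
Proof.
elim: s M z f h => [|p s IH] M z f h adm col.
  rewrite /pairing /= mul0r subr0.
  have -> : \sum_b f b * H ((1%g : {perm V}) b) (map (1%g : {perm V}) z) = \sum_b f b * H b z.
    by apply: eq_bigr => b _; rewrite perm1 (eq_map (@perm1 V)) map_id.
  exact: H_bound.
have col' := colored_sub (sub_rematch M p) col.
have [/andP[/andP[aM bM] /andP[az bz]]|nomerge] :=
    boolP (matchable M p && ((p.1 \notin z) && (p.2 \notin z))); last first.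
  have g0 : (if matchable M p then h p.1 p.2 else 0) = 0.
    case: ifP nomerge => //= /andP[aM bM] nz; rewrite col //.
    by rewrite (negbTE nz).
  have I1 := IH _ _ _ _ adm col'.
  have I2 := IH _ _ _ _ (admissible_tau p adm) (colored_tau (p:=p) col').
  rewrite (sum_tau p (fun x => f x ^+ 2)) in I2.
  rewrite pairing_cons /= g0.
  set X := pairing _ _ _ in I1 *; set Y := pairing _ _ _ in I2 *.
  have : ((X + Y) / 2) ^+ 2 <= (X ^+ 2 + Y ^+ 2) / 2.
    by have := sqr_ge0 (X - Y); nra.
  move: I1 I2; set A := gain _ _ _; set B := gain _ _ _; set S := \sum_b _.
  by lra.
set f' := fun x => (f x + f (tau p x)) / 2.
have adm' : admissible z f' by exact: admissible_average.
have mapz : map (tau p) z = z.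
  rewrite -[RHS]map_id; apply/eq_in_map => x xz; apply: tau_out.
  by rewrite !inE; apply/norP; split; apply: contraTneq xz => ->.
have mM : matchable M p by apply/andP.
(* Averaging changes [f] only at the two ends, which are matched from now on, so [h] still describes
   the jumps between unmatched particles. *)
have ff' x : x \notin rematch M p -> f' x = f x.
  rewrite /rematch mM finset.in_setU negb_or => /andP[/tau_out xp _]; rewrite /f' xp; by field.
have c1 : colored (rematch M p) z f' h.
  by move=> a b aM' bM'; rewrite col' // !ff'.
have c2 : colored (moved (tau p) (rematch M p)) z f'
     (fun x y => h (tau p x) (tau p y)).
  have := colored_tau (p := p) c1; rewrite mapz => c2 a b aM' bM'.
  rewrite c2 //; suff E x : f' (tau p x) = f' x by rewrite !E.
  by rewrite /f' tauK addrC.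
have I1 := IH _ _ _ _ adm' c1.
have I2 := IH _ _ _ _ adm' c2.
rewrite sum_average_sqr in I1 I2.
have -> : pairing (p :: s) z f = pairing s z f'.
  rewrite pairing_cons mapz /pairing -big_split mulr_suml.
  by apply: eq_bigr => b _; rewrite /= -mulrDl mulrAC.
rewrite /= mM col // az bz /=.
move: I1 I2; set A := gain _ _ _; set B := gain _ _ _; set S := \sum_b _.
set D := (_ - _) ^+ 2.
lra.
Qed.

End SquareBound.

Lemma gain_sum (I : finType) s (c : I -> R) (h : I -> V -> V -> R) M :
  gain s (fun x y => \sum_i c i * h i x y) M = \sum_i c i * gain s (h i) M.
Proof.
elim: s h M => [|p s IH] h M /=; first by rewrite big1 // => i _; rewrite mulr0.
rewrite !IH -big_split mulr_suml /=.
have -> : (if matchable M p then \sum_i c i * h i p.1 p.2 else 0) =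
   \sum_i c i * (if matchable M p then h i p.1 p.2 else 0).
  by case: ifP => // _; rewrite big1 // => i _; rewrite mulr0.
by rewrite -big_split; apply: eq_bigr => i _ /=; ring.
Qed.

Lemma gain_ge0 s h M : (forall x y, 0 <= h x y) -> 0 <= gain s h M.
Proof.
elim: s h M => [|p s IH] h M h0 //=; apply: addr_ge0; first by case: ifP.
by apply: divr_ge0 => //; apply: addr_ge0; apply: IH.
Qed.

(* [U] is the set of vertices that have already rung, and [d x] counts how often
   the particle at [x] was the partner in the first ring of a vertex.  Averaging
   [d] over the coins keeps it below the indicator of [U], since the particle
   sitting at the freshly rung vertex swaps with its partner with probability
   1/2.  [fresh_gain] is the expected increase of the sum of [phi (d x)], where
   [phi] is defined below. *)
Fixpoint fresh_gain s U d : R :=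
  if s is p :: s' then
    (p.2 \notin U)%:R * (5 / 9 - 2 / 9 * d p.1) +
    (p.1 \notin U)%:R * (5 / 9 - 2 / 9 * d p.2) +
    let d' := fun x => d x + (x == p.1)%:R * (p.2 \notin U)%:R
                           + (x == p.2)%:R * (p.1 \notin U)%:R in
    fresh_gain s' ([set p.1; p.2]%SET :|: U) (fun x => (d' x + d' (tau p x)) / 2)
  else 0.

Lemma fresh_gain_mid s U d d' :
  fresh_gain s U (fun x => (d x + d' x) / 2) = (fresh_gain s U d + fresh_gain s U d') / 2.
Proof.
elim: s U d d' => [|p s IH] U d d' /=; first by rewrite addr0 mul0r.
set T := (X in _ + _ + X = _).
match goal with |- _ = (_ + ?a + (_ + ?b)) / 2 => set A := a; set B := b end.
have -> : T = (A + B) / 2.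
  by rewrite /T /A /B -IH; congr fresh_gain; apply/funext => x; by field.
by field.
Qed.

Definition rung s : {set V} := [set x | has (fun p => (x == p.1) || (x == p.2)) s]%SET.

(** As [d] is at most 1, each freshly rung vertex contributes at least 5/9 - 2/9 = 1/3. *)
Lemma fresh_gain_ge s U d : all (fun p => p.1 != p.2) s ->
  (forall x, d x <= (x \in U)%:R) ->
  (#|rung s :|: U|%:R - #|U|%:R) / 3 <= fresh_gain s U d.
Proof.
elim: s U d => [|p s IH] U d /=.
  move=> _ _; have -> : rung [::] = finset.set0 by apply/setP => x; rewrite !inE.
  by rewrite finset.set0U subrr mul0r.
move=> /andP[ab ds] dU.
have -> : rung (p :: s) :|: U = rung s :|: ([set p.1; p.2] :|: U)%SET.
  by apply/setP => x; rewrite !inE /= -!orbA; do !bool_congr.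
set d' := fun x => (d x + (x == p.1)%:R * (p.2 \notin U)%:R + (x == p.2)%:R * (p.1 \notin U)%:R +
  (d (tau p x) + (tau p x == p.1)%:R * (p.2 \notin U)%:R +
   (tau p x == p.2)%:R * (p.1 \notin U)%:R)) / 2.
have := IH ([set p.1; p.2]%SET :|: U) d' ds.
set J := fresh_gain _ _ _ => IH'.
(* At either end, the two values of [d] are bounded by the indicators of [U] and the two increments
   are the complementary indicators; half of their sum is at most 1. *)
have /IH' : forall x, d' x <= (x \in ([set p.1; p.2] :|: U)%SET)%:R.
  have ba : p.2 != p.1 by rewrite eq_sym.
  move=> x; have := dU p.1; have := dU p.2; have := dU x.
  have tL : tau p p.1 = p.2 by exact: tpermL.
  have tR : tau p p.2 = p.1 by exact: tpermR.
  rewrite /d' !inE; have [->|xa] := eqVneq x p.1.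
    rewrite tL !eqxx (negbTE ab) (negbTE ba) /=.
    by case: (p.1 \in U); case: (p.2 \in U) => /=; lra.
  have [->|xb] := eqVneq x p.2.
    rewrite tR !eqxx (negbTE ab) /=.
    by case: (p.1 \in U); case: (p.2 \in U) => /=; lra.
  rewrite tau_out ?inE ?negb_or ?xa // (negbTE xa) (negbTE xb) /=.
  by lra.
have cU : #|[set p.1; p.2] :|: U|%SET%:R <= #|U|%:R + (p.1 \notin U)%:R + (p.2 \notin U)%:R :> R.
  rewrite -!natrD ler_nat -finset.setUA.
  by rewrite !cardsU1 addnC !finset.inE;
    case: (p.1 == p.2) (p.1 \in U) (p.2 \in U) => [] [] []; lia.
have := dU p.1; have := dU p.2.
case: (p.1 \in U) cU; case: (p.2 \in U) => /= cU; lra.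
Qed.

(* As [phi u <= 1] and [phi 0 = 0], the sum of [phi (d x)] bounds the number of
   matched particles from below: one with [d x > 0] has met an unmatched particle. *)
Let phi (u : R) := 2 / 3 * u - u ^+ 2 / 9.

(** Since [phi (u + 1) - phi u = 5/9 - 2/9 * u], [fresh_gain] accounts for the growth of the sum of
    [phi (d x)]. In the end that sum is at most the number of matched particles, and each match
    creates two of these. *)
Lemma gain_fresh s M U d : all (fun p => p.1 != p.2) s ->
  M \subset U -> (forall x, x \notin M -> d x = 0) ->
  (\sum_x phi (d x) - #|M|%:R + fresh_gain s U d) / 2
    <= gain s (fun x y => (x != y)%:R) M.
Proof.
elim: s M U d => [|p s IH] M U d /=.
  move=> _ _ dM; rewrite addr0.
  (* The bound [phi u <= 1] comes from [1 - phi u = (u - 3)^2 / 9]. *)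
  have : \sum_x phi (d x) <= #|M|%:R.
    rewrite -sum1_card natr_sum [X in _ <= X]big_mkcond /=; apply: ler_sum => x _.
    rewrite /phi; case: ifPn => [_|/dM ->]; last by lra.
    by have := sqr_ge0 (d x - 3); nra.
  by lra.
move=> /andP[ab ds] MU dM.
set d1 := fun x => d x + (x == p.1)%:R * (p.2 \notin U)%:R + (x == p.2)%:R * (p.1 \notin U)%:R.
set U' := (_ :|: U)%SET.
set M' := rematch M p.
have tU x : (tau p x \in U') = (x \in U').
  have tL : tau p p.1 = p.2 by exact: tpermL.
  have tR : tau p p.2 = p.1 by exact: tpermR.
  rewrite !inE; have [->|xa] := eqVneq x p.1.
    by rewrite tL eqxx orbT.
  have [->|xb] := eqVneq x p.2; first by rewrite tR eqxx.
  by rewrite tau_out ?inE ?negb_or ?xa // (negbTE xa) (negbTE xb).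
have M'U : M' \subset U'.
  rewrite /M' /rematch; case: ifP => _; first exact: finset.setUS.
  by apply: fintype.subset_trans MU _; exact: finset.subsetUr.
have tM'U : moved (tau p) M' \subset U'.
  by apply/fintype.subsetP => x; rewrite inE => /(fintype.subsetP M'U); rewrite tU.
(* An end outside [U] is unmatched because [M] lies in [U]; hence its partner either was matched
   before or is matched now, and [d1] grows only on matched vertices. *)
have d1M x : x \notin M' -> d1 x = 0.
  rewrite /M' /rematch /d1 /matchable; case: ifPn => [_|].
    by rewrite !inE !negb_or => /andP[/andP[/negbTE -> /negbTE ->] /dM ->]; rewrite !mul0r !addr0.
  rewrite negb_and !negbK => mm xM; rewrite (dM x xM) add0r.
  have [xa|xa] := eqVneq x p.1.
    have -> : (x == p.2) = false by rewrite xa; apply/negbTE.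
    rewrite mul0r addr0 mul1r; rewrite -xa (negbTE xM) /= in mm.
    by rewrite (fintype.subsetP MU _ mm).
  rewrite mul0r add0r; have [xb|xb] := eqVneq x p.2; last by rewrite mul0r.
  rewrite -xb (negbTE xM) orbF in mm.
  by rewrite (fintype.subsetP MU _ mm) mulr0.
have d1tM x : x \notin moved (tau p) M' -> d1 (tau p x) = 0.
  by rewrite inE => /d1M.
have I1 := IH _ _ _ ds M'U d1M.
have I2 := IH _ _ _ ds tM'U d1tM.
rewrite (sum_tau p (fun x => phi (d1 x))) card_moved in I2.
have -> : (fun x y => (tau p x != tau p y)%:R) = (fun x y => (x != y)%:R) :> (V -> V -> R).
  by apply/funext => x; apply/funext => y; rewrite (inj_eq perm_inj).
rewrite ab fresh_gain_mid.
have cM : #|M'|%:R <= #|M|%:R + 2 * (if matchable M p then 1 else 0) :> R.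
  rewrite /M' /rematch; case: ifP => _; last by lra.
  rewrite mulr1 addrC -natrD ler_nat.
  by apply: leq_trans (leq_card_setU _ _) _; rewrite cards2 ab.
have phid : \sum_x phi (d1 x) = \sum_x phi (d x) +
   (p.2 \notin U)%:R * (5 / 9 - 2 / 9 * d p.1) +
    (p.1 \notin U)%:R * (5 / 9 - 2 / 9 * d p.2).
  have ba : p.2 != p.1 by rewrite eq_sym.
  rewrite (bigD1 p.1) //= (bigD1 p.2) //= [in RHS](bigD1 p.1) //= [in RHS](bigD1 p.2) //=.
  have -> : \sum_(i | (i != p.1) && (i != p.2)) phi (d1 i) =
      \sum_(i | (i != p.1) && (i != p.2)) phi (d i).
    by apply: eq_bigr => x /andP[/negbTE xa /negbTE xb]; rewrite /d1 xa xb !mul0r !addr0.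
  rewrite /d1 !eqxx (negbTE ab) (negbTE ba) /phi.
  by case: (p.1 \in U); case: (p.2 \in U) => /=; by field.
rewrite phid in I1 I2; move: I1 I2 cM.
change (fresh_gain s U' (fun x => d1 x)) with (fresh_gain s U' d1).
set J1 := fresh_gain s U' d1; set J2 := fresh_gain s U' _.
case: (matchable M p) => /=; lra.
Qed.

Lemma gain_ge_rung s : all (fun p => p.1 != p.2) s ->
  #|rung s|%:R / 6 <= gain s (fun x y => (x != y)%:R) finset.set0.
Proof.
move=> ds.
have H1 := @gain_fresh s finset.set0 finset.set0 (fun=> 0) ds (finset.sub0set _) (fun _ _ => erefl).
have H2 := @fresh_gain_ge s finset.set0 (fun=> 0) ds (fun x => ler0n _ _).
rewrite finset.setU0 finset.cards0 in H2; rewrite finset.cards0 big1 in H1; first by lra.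
by move=> x _; rewrite /phi; ring.
Qed.

End Chameleon.

(** * Means over rings and coins *)

Section Mean.
Variables (R : realType) (T : Type).
Implicit Types (P : T -> Prop) (L : (T -> R) -> R) (F : T -> R).

(** An expectation, given as a normalized positive linear functional. [P] holds almost surely:
    positivity of [F] is only asked on [P]. *)
Record is_mean P L : Prop := IsMean {
  mean_lin : forall a F F', L (fun x => a * F x + F' x) = a * L F + L F';
  mean_ge0 : forall F, (forall x, P x -> 0 <= F x) -> 0 <= L F;
  mean_one : L (fun=> 1) = 1 }.

Variables (P : T -> Prop) (L : (T -> R) -> R).
Hypothesis mL : is_mean P L.

Lemma mean0 : L (fun=> 0) = 0.
Proof.
have := mean_lin mL 1 (fun=> 0) (fun=> 0).
rewrite (_ : (fun _ => _) = (fun=> 0)); last by apply/funext => x; ring.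
by lra.
Qed.

Lemma mean_scale a F : L (fun x => a * F x) = a * L F.
Proof.
have := mean_lin mL a F (fun=> 0); rewrite mean0 addr0 => <-.
by congr L; apply/funext => x; rewrite addr0.
Qed.

Lemma meanD F F' : L (fun x => F x + F' x) = L F + L F'.
Proof.
have := mean_lin mL 1 F F'; rewrite mul1r => <-.
by congr L; apply/funext => x; rewrite mul1r.
Qed.

Lemma mean_const c : L (fun=> c) = c.
Proof.
rewrite -[RHS]mulr1 -(mean_one mL) -mean_scale.
by congr L; apply/funext => x; rewrite mulr1.
Qed.

Lemma mean_sum (I : finType) (c : I -> R) (F : I -> T -> R) :
  L (fun x => \sum_i c i * F i x) = \sum_i c i * L (F i).
Proof.
transitivity (\sum_(i <- index_enum I) c i * L (F i)) => //.
elim: (index_enum I) => [|i r IH].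
  rewrite big_nil -[RHS]mean0; congr L; apply/funext => x.
  by rewrite big_nil.
rewrite big_cons -IH -(mean_lin mL); congr L; apply/funext => x.
by rewrite big_cons.
Qed.

Lemma mean_le F F' : (forall x, P x -> F x <= F' x) -> L F <= L F'.
Proof.
move=> FF'; rewrite -subr_ge0.
have -> : L F' - L F = L (fun x => -1 * F x + F' x) by rewrite (mean_lin mL); ring.
by apply: (mean_ge0 mL) => x /FF'; lra.
Qed.

(** The variance is nonnegative. *)
Lemma mean_sqr F : L F ^+ 2 <= L (fun x => F x ^+ 2).
Proof.
set m := L F.
have : 0 <= L (fun x => - (2 * m) * F x + (F x ^+ 2 + m ^+ 2)).
  apply: (mean_ge0 mL) => x _; have := sqr_ge0 (F x - m); lra.
by rewrite (mean_lin mL) meanD mean_const -/m; lra.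
Qed.

End Mean.

Lemma coin_mean_is_mean (R : realType) (V : finType) s :
  is_mean (fun _ : {perm V} => True) (@coin_mean R V s).
Proof.
elim: s => [|p s IH]; split=> [a F F'|F F0|] //=.
- exact: F0.
- by rewrite !(mean_lin IH); field.
- apply: divr_ge0 => //.
  by apply: addr_ge0; apply: (mean_ge0 IH) => r _; exact: F0.
- by rewrite !(mean_one IH); field.
Qed.

(** * Random rings in discrete time *)

Section Steps.
Variables (R : realType) (G : weighted_graph R) (x0 : G) (h : R).

(* The default [(x0, x0)] never occurs on an edge. *)
Definition ends (e : {set G}) : G * G :=
  if [pick p : G * G | e == [set p.1; p.2]%SET] is Some p then p else (x0, x0).

Lemma edge_swap_ends e : edge_swap e = tperm (ends e).1 (ends e).2.
Proof. by rewrite /edge_swap /ends; case: pickP => //= _; rewrite tperm1. Qed.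

Lemma ends_neq e : e \in edges G -> (ends e).1 != (ends e).2.
Proof.
move=> /edges_card2; rewrite /ends; case: pickP => [p /eqP ->|none].
  by rewrite cards2; case: (_ == _).
by move=> /eqP /cards2P [a [b [ab E]]]; have := none (a, b); rewrite /= E eqxx.
Qed.

Definition total_weight : R := \sum_(e in edges G) weight e.

(** The argument of [F] lists the edges that ring, in order of time; a step in which nothing rings
    leaves no entry. *)
Fixpoint ring_mean (N : nat) (F : seq (G * G) -> R) : R :=
  if N is N'.+1 then
    (1 - 2 * h * total_weight) * ring_mean N' F +
    \sum_(e in edges G) 2 * h * weight e * ring_mean N' (fun s => F (ends e :: s))
  else F [::].

Hypotheses (h_ge0 : 0 <= h) (h_small : 2 * h * total_weight <= 1).

Definition loopless (s : seq (G * G)) : Prop := all (fun p => p.1 != p.2) s.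

Lemma ring_mean_is_mean N : is_mean loopless (ring_mean N).
Proof.
elim: N => [|N IH]; split=> [a F F'|F F0|] //=.
- exact: F0.
- rewrite (mean_lin IH).
  have -> : \sum_(e in edges G) 2 * h * weight e *
      ring_mean N (fun s => a * F (ends e :: s) + F' (ends e :: s)) =
     \sum_(e in edges G) (a * (2 * h * weight e * ring_mean N (fun s => F (ends e :: s)))
     + 2 * h * weight e * ring_mean N (fun s => F' (ends e :: s))).
    by apply: eq_bigr => e _; rewrite (mean_lin IH); ring.
  by rewrite big_split /= -mulr_sumr; ring.
- apply: addr_ge0.
    by apply: mulr_ge0; [rewrite subr_ge0|apply: (mean_ge0 IH)].
  apply: sumr_ge0 => e eE; apply: mulr_ge0.
    by rewrite mulr_ge0 ?mulr_ge0 // ltW // weight_gt0.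
  apply: (mean_ge0 IH) => s ps; apply: F0; apply/andP; split=> //.
  exact: ends_neq.
- rewrite !(mean_one IH) /total_weight mulr1.
  have -> : \sum_(e in edges G) 2 * h * weight e * 1 = 2 * h * \sum_(e in edges G) weight e.
    by rewrite mulr_sumr; apply: eq_bigr => e _; rewrite mulr1.
  by ring.
Qed.

Definition ip_mean N (F : {perm G} -> R) : R := ring_mean N (fun s => coin_mean s F).

Lemma ip_mean_is_mean N : is_mean (fun _ : {perm G} => True) (ip_mean N).
Proof.
have mN := ring_mean_is_mean N; split=> [a F F'|F F0|].
- rewrite /ip_mean -(mean_lin mN); congr ring_mean.
  by apply/funext => s; rewrite (mean_lin (coin_mean_is_mean R s)).
- by apply: (mean_ge0 mN) => s _; apply: (mean_ge0 (coin_mean_is_mean R s)).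
- rewrite -[RHS](mean_one mN); congr ring_mean.
  by apply/funext => s; rewrite (mean_one (coin_mean_is_mean R s)).
Qed.

Lemma ip_mean0 F : ip_mean 0 F = F 1%g. Proof. by []. Qed.

(** Half of the ringing probability [2 * h * weight e] goes back to staying put, because of the
    coin. What remains is the recursion of the step 1 + hQ. *)
Lemma ip_meanS N F : ip_mean N.+1 F =
  (1 - h * total_weight) * ip_mean N F +
  \sum_(e in edges G) h * weight e * ip_mean N (fun r => F (edge_swap e * r)%g).
Proof.
rewrite /ip_mean /=; have mN := ring_mean_is_mean N.
set A := ring_mean N (fun s => coin_mean s F).
have -> : \sum_(e in edges G) 2 * h * weight e *
    ring_mean N (fun s => (coin_mean s F +
      coin_mean s (fun r => F (tperm (ends e).1 (ends e).2 * r)%g)) / 2) =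
  \sum_(e in edges G) (h * weight e * A + h * weight e *
    ring_mean N (fun s => coin_mean s (fun r => F (edge_swap e * r)%g))).
  apply: eq_bigr => e _; rewrite edge_swap_ends.
  set f1 := fun s => coin_mean s F; set f2 := fun s => coin_mean s _.
  have -> : (fun s => (coin_mean s F + coin_mean s (fun r => F (tperm (ends e).1 (ends e).2 * r)%g)) / 2)
     = (fun s => 2^-1 * (f1 s + f2 s)) by apply/funext => s; rewrite mulrC.
  rewrite (mean_scale mN) (meanD mN) -/A; by field.
rewrite big_split /= -mulr_suml -mulr_sumr -/total_weight; ring.
Qed.

(** Markov property: the first [N] steps produce [s], the other [N'] an independent [r]. *)
Lemma ip_meanD N N' F :
  ip_mean (N + N') F = ip_mean N (fun s => ip_mean N' (fun r => F (s * r)%g)).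
Proof.
elim: N F => [|N IH] F.
  by rewrite ip_mean0; congr ip_mean; apply/funext => r; rewrite mul1g.
rewrite addSn !ip_meanS IH; congr (_ + _); apply: eq_bigr => e _; rewrite IH.
congr (_ * ip_mean _ _); apply/funext => s; congr ip_mean; apply/funext => r.
by rewrite mulgA.
Qed.

Lemma coin_mean_fixed s (b : G) : b \notin rung s ->
  coin_mean s (fun r => (r b == b)%:R) = 1 :> R.
Proof.
elim: s => [|p s IH] /=; first by rewrite perm1 eqxx.
rewrite inE /= !negb_or => /andP[/andP[b1 b2] bs].
have bs' : b \notin rung s by rewrite inE.
rewrite (_ : (fun r : {perm G} => ((tperm p.1 p.2 * r)%g b == b)%:R) = (fun r => (r b == b)%:R)); last first.
  by apply/funext => r; rewrite permM tpermD // eq_sym.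
by rewrite !IH //; field.
Qed.

(** A vertex that never rings is a fixed point whatever the coins, so fixed points bound the number
    of silent vertices. *)
Lemma ring_mean_rung N :
  #|G|%:R - \sum_b ip_mean N (fun r => (r b == b)%:R) <=
  ring_mean N (fun s => #|rung s|%:R).
Proof.
have mN := ring_mean_is_mean N.
have -> : #|G|%:R - \sum_b ip_mean N (fun r => (r b == b)%:R) =
  ring_mean N (fun s => \sum_b - 1 * coin_mean s (fun r => (r b == b)%:R) + #|G|%:R).
  rewrite (meanD mN) (mean_const mN) (mean_sum mN) -mulr_sumr; ring.
apply: (mean_le mN) => s _.
have -> : #|G|%:R = \sum_(b : G) 1 :> R by rewrite sumr_const.
have -> : #|rung s|%:R = \sum_b (if b \in rung s then 1 else 0) :> R.
  by rewrite -sum1_card natr_sum big_mkcond.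
rewrite -big_split; apply: ler_sum => b _ /=; rewrite mulN1r addrC.
case: ifPn => [_|nb]; last by rewrite coin_mean_fixed // subrr.
rewrite lerBlDr lerDl; apply: (mean_ge0 (coin_mean_is_mean R s)) => r _.
exact: ler0n.
Qed.

End Steps.

(** * Contraction over a round *)

Section Sums.
Variables (R : realType) (V : finType).

Lemma sum_const (c : R) : \sum_(x : V) c = #|V|%:R * c.
Proof. by rewrite sumr_const mulr_natl. Qed.

Lemma sum_sqr_le (g : V -> R) : (\sum_x g x) ^+ 2 <= #|V|%:R * \sum_x g x ^+ 2.
Proof.
have : 0 <= \sum_x \sum_y (g x - g y) ^+ 2.
  by apply: sumr_ge0 => x _; apply: sumr_ge0 => y _; exact: sqr_ge0.
have -> : \sum_x \sum_y (g x - g y) ^+ 2 =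
  \sum_x (#|V|%:R * g x ^+ 2 + \sum_y g y ^+ 2 - 2 * (\sum_y g y) * g x).
  apply: eq_bigr => x _.
  have -> : \sum_y (g x - g y) ^+ 2 = \sum_y (g x ^+ 2 + g y ^+ 2 + (- (2 * g x)) * g y).
    by apply: eq_bigr => y _; ring.
  rewrite !big_split /= sum_const -[\sum_i - _ * _]mulr_sumr; ring.
rewrite !big_split /= sumrN -!mulr_sumr sum_const.
set n := #|V|%:R; set S := \sum_x _; set Q := \sum_x _; lra.
Qed.

(** As [f] vanishes on [z], the cross terms may be summed over all vertices, where they cancel
    because [f] has total mass 0. *)
Lemma sum_pairs_out (z : seq V) (f : V -> R) : uniq z ->
  (forall x, x \in z -> f x = 0) -> \sum_x f x = 0 ->
  \sum_x \sum_y (if (x \notin z) && (y \notin z) then (f x - f y) ^+ 2 else 0) =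
  2 * (#|V|%:R - (size z)%:R) * \sum_x f x ^+ 2.
Proof.
move=> uz fz sf.
have si : \sum_x (x \notin z)%:R = #|V|%:R - (size z)%:R :> R.
  have -> : (size z)%:R = \sum_x (x \in z)%:R :> R.
    rewrite -(card_uniqP uz) -sum1_card natr_sum big_mkcond /=.
    by apply: eq_bigr => x _; case: ifP.
  have -> : #|V|%:R = \sum_(x : V) 1 :> R by rewrite sum_const mulr1.
  rewrite -sumrB; apply: eq_bigr => x _; by case: (x \in z); rewrite ?subrr ?subr0.
transitivity (\sum_x \sum_y (f x ^+ 2 * (y \notin z)%:R
    + ((x \notin z)%:R * f y ^+ 2 + (- (2 * f x)) * f y))).
  apply: eq_bigr => x _; apply: eq_bigr => y _.
  by case: (boolP (x \in z)) => [/fz ->|_]; case: (boolP (y \in z)) => [/fz ->|_] /=;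
    rewrite ?mulr1n ?mulr0n; ring.
transitivity (\sum_x (f x ^+ 2 * (#|V|%:R - (size z)%:R) + (x \notin z)%:R * \sum_y f y ^+ 2)).
  apply: eq_bigr => x _; rewrite !big_split /= -!mulr_sumr si sf; ring.
rewrite big_split /= -!mulr_suml si; ring.
Qed.

(** The entries are corrected from left to right. The factor 2 is there because the new value [b]
    may already occur further right, and then that entry must first give way. *)
Lemma one_change_chain (k : nat) (H : seq V -> R) (delta : R) :
  0 <= delta -> (k < #|V|)%N ->
  (forall s1 a b s2, uniq (s1 ++ a :: s2) -> uniq (s1 ++ b :: s2) ->
     size (s1 ++ a :: s2) = k -> `|H (s1 ++ a :: s2) - H (s1 ++ b :: s2)| <= delta) ->
  forall x y, uniq x -> uniq y -> size x = k -> size y = k ->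
    `|H x - H y| <= 2 * k%:R * delta.
Proof.
move=> d0 kV step.
suff main x y : forall s, uniq (s ++ x) -> uniq (s ++ y) -> size x = size y ->
    size (s ++ x) = k -> `|H (s ++ x) - H (s ++ y)| <= 2 * (size x)%:R * delta.
  move=> x y ux uy sx sy; rewrite -{1}sx; apply: (main x y [::]) => //.
  by rewrite sx sy.
have [n] := ubnP (size x); elim: n x y => // n IH [|a x] [|b y] // szx s ux uy.
  by rewrite subrr normr0 mulr0 mul0r.
rewrite [size (a :: x)]/= => -[sxy] sk.
have sk' c l : size l = size x -> size (s ++ c :: l) = k.
  by move=> sl; rewrite -sk !size_cat /= sl.
have tail l : size l = size x -> uniq (s ++ b :: l) ->
    `|H (s ++ b :: l) - H (s ++ b :: y)| <= 2 * (size x)%:R * delta.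
  move=> sl ul; rewrite -sl -!cat_rcons; apply: IH; rewrite ?cat_rcons ?sk' ?sl //.
have two l : size l = size x -> uniq (s ++ b :: l) ->
   `|H (s ++ a :: x) - H (s ++ b :: l)| <= 2 * delta ->
   `|H (s ++ a :: x) - H (s ++ b :: y)| <= 2 * (size x).+1%:R * delta.
  move=> sl ul h; have := tail l sl ul.
  have := ler_distD (H (s ++ b :: l)) (H (s ++ a :: x)) (H (s ++ b :: y)).
  rewrite -natr1; move: h; set A := `|_|; set B := `|_|; set D := `|_|; lra.
have piv s0 c l : uniq (s0 ++ c :: l) = (c \notin s0 ++ l) && uniq (s0 ++ l).
  by rewrite -cat1s uniq_catCA.
have [ba|ba] := eqVneq b a.
  by apply: (two x); rewrite -?ba in ux *; rewrite // subrr normr0; lra.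
have bs : b \notin s by move: uy; rewrite piv mem_cat negb_or => /andP[/andP[]].
have [bx|bx] := boolP (b \in x); last first.
  have ub : uniq (s ++ b :: x).
    have bsx : b \notin s ++ x by rewrite mem_cat negb_or bs.
    by move: ux; rewrite !piv bsx => /andP[].
  apply: (two x) => //; have := step s a b x ux ub (sk' _ _ erefl); lra.
(* A free vertex [c], available since [k < #|V|], takes the place of the later occurrence of [b]. *)
have [c cx] : exists c, c \notin s ++ a :: x.
  apply/existsP; apply: contraTT kV => /existsPn all_in; rewrite -leqNgt -sk.
  rewrite -(card_uniqP ux); apply/subset_leq_card/fintype.subsetP => c _.
  by have := all_in c; rewrite negbK.
case/path.splitPr: bx ux sk sk' two cx => l r ux sk sk' two cx.
have E1 d : s ++ a :: l ++ d :: r = (s ++ a :: l) ++ d :: r by rewrite -catA.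
have piv2 d : uniq (s ++ a :: l ++ d :: r) =
    (d \notin (s ++ a :: l) ++ r) && uniq ((s ++ a :: l) ++ r).
  by rewrite E1 piv.
have uc : uniq (s ++ a :: l ++ c :: r).
  move: ux cx; rewrite !piv2 => /andP[_ ->]; rewrite andbT.
  rewrite !(mem_cat, inE).
  by case: (c \in s); case: (c == a); case: (c \in l); case: (c == b); case: (c \in r).
have ub : uniq (s ++ b :: l ++ c :: r).
  have cb : c != b.
    apply: contraNneq cx => ->; rewrite !(mem_cat, inE) eqxx; do ?rewrite orbT //.
  move: ux; rewrite piv2 => /andP[bn _]; move: uc; rewrite !piv => /andP[_ ->].
  move: bn cb; rewrite !(mem_cat, inE) [c == b]eq_sym.
  by case: (b \in s); case: (b == a); case: (b \in l); case: (b == c); case: (b \in r).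
have sl : size (l ++ c :: r) = size (l ++ b :: r) by rewrite !size_cat.
apply: (two (l ++ c :: r)) => //.
have h1 : `|H (s ++ a :: l ++ b :: r) - H (s ++ a :: l ++ c :: r)| <= delta.
  by rewrite !E1; apply: step; rewrite -?E1.
have h2 := step s a b (l ++ c :: r) uc ub (sk' _ _ sl).
have := ler_distD (H (s ++ a :: l ++ c :: r)) (H (s ++ a :: l ++ b :: r)) (H (s ++ b :: l ++ c :: r)).
move: h1 h2; set A := `|_|; set B := `|_|; set D := `|_|; lra.
Qed.

End Sums.

Section Contraction.
Variables (R : realType) (G : weighted_graph R) (x0 : G) (h : R) (N k : nat).
Hypotheses (h_ge0 : 0 <= h) (h_small : 2 * h * total_weight G <= 1).
Hypothesis G_large : (2 * k.+1 <= #|G|)%N.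

Local Notation ipm := (ip_mean x0 h).

(** This and [pair_spread] are what the mixing of two particles within [N] steps provides: the first
    serves the matching phase of a round, the second the [N + N] steps before it. *)
Hypothesis fixed_points : \sum_b ipm N (fun r => (r b == b)%:R) <= 1 + #|G|%:R / 3.
Hypothesis pair_spread : forall (v w : G) (alpha : G -> G -> R), v != w ->
  (forall a b, 0 <= alpha a b) ->
  (\sum_a \sum_b (a != b)%:R * alpha a b) / (3 * #|G|%:R ^+ 2)
    <= ipm (N + N) (fun r => alpha (r v) (r w)).

Let mN := ring_mean_is_mean x0 h_ge0 h_small N.
Let mNN := ip_mean_is_mean x0 h_ge0 h_small (N + N).

Definition mean_gain (g : G -> G -> R) : R :=
  ring_mean x0 h N (fun s => gain s g finset.set0).

(** The probability that the particles from [a] and [b] are matched with each other, in the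
    orientation given by [ends]; summed over ordered pairs it is the expected number of matches. *)
Definition pair_gain (a b : G) : R :=
  mean_gain (fun x y => ((x == a) && (y == b))%:R).

Lemma mean_gainE g : mean_gain g = \sum_a \sum_b g a b * pair_gain a b.
Proof.
rewrite pair_bigA /= /pair_gain /mean_gain -(mean_sum mN); congr ring_mean.
apply/funext => s; rewrite -gain_sum; congr gain; apply/funext => x; apply/funext => y.
rewrite (bigD1 (x, y)) //= !eqxx mulr1 big1 ?addr0 // => [[a b]] /=.
rewrite xpair_eqE eq_sym [b == y]eq_sym; case: (_ && _) => //=.
by rewrite mulr0.
Qed.

Lemma pair_gain_ge0 a b : 0 <= pair_gain a b.
Proof. by apply: (mean_ge0 mN) => s _; apply: gain_ge0 => x y; exact: ler0n. Qed.

(** With n vertices, at least n - (1 + n/3) of them ring on average, which is at least n/6 as n is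
    at least 2; [gain_ge_rung] gives the other factor 1/6. *)
Lemma total_gain : #|G|%:R / 36 <= \sum_a \sum_b (a != b)%:R * pair_gain a b.
Proof.
rewrite -mean_gainE.
have := ring_mean_rung x0 h_ge0 h_small N.
have : ring_mean x0 h N (fun s => 6^-1 * #|rung s|%:R) <=
    mean_gain (fun x y => (x != y)%:R).
  apply: (mean_le mN) => s /gain_ge_rung; rewrite mulrC; exact.
rewrite (mean_scale mN).
have : 2 <= #|G|%:R :> R by rewrite (ler_nat _ 2); lia.
move: fixed_points; set A := \sum_b _; set B := ring_mean _ _ _ _.
set C := mean_gain _; set n := #|G|%:R; lra.
Qed.

Section Round.
Variables (H : G -> seq G -> R) (C : R).
Hypothesis C_ge0 : 0 <= C.
Hypothesis H_bound : forall z f, admissible k z f ->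
  (\sum_b f b * H b z) ^+ 2 <= C * \sum_b f b ^+ 2.

Definition pair_energy (z : seq G) (f : G -> R) (x y : G) : R :=
  if (x \notin z) && (y \notin z) then (f x - f y) ^+ 2 else 0.

Lemma matching_steps z f : admissible k z f ->
  (\sum_b f b * ipm N (fun r => H (r b) (map r z))) ^+ 2 <=
  C * (\sum_b f b ^+ 2 - mean_gain (pair_energy z f) / 2).
Proof.
move=> adm.
have -> : \sum_b f b * ipm N (fun r => H (r b) (map r z)) =
    ring_mean x0 h N (fun s => pairing H s z f) by rewrite /ip_mean -(mean_sum mN).
apply: le_trans (mean_sqr mN _) _.
have -> : C * (\sum_b f b ^+ 2 - mean_gain (pair_energy z f) / 2) =
  ring_mean x0 h N (fun s => C * (- 2^-1 * gain s (pair_energy z f) finset.set0 + \sum_b f b ^+ 2)).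
  rewrite (mean_scale mN) (meanD mN) (mean_const mN) (mean_scale mN) /mean_gain.
  by congr (C * _); rewrite addrC mulNr mulrC.
apply: (mean_le mN) => s _.
have col : colored finset.set0 z f (pair_energy z f) by [].
have := pairing_sqr H_bound s adm col.
set X := pairing _ _ _ _; set Y := gain _ _ _; set Z := \sum_b _; lra.
Qed.

Lemma admissible_perm (r : {perm G}) z (f : G -> R) :
  admissible k z f -> admissible k (map r z) (fun x => f (r^-1%g x)).
Proof.
case=> uz sz fz sf; split; rewrite ?size_map ?map_inj_uniq //.
- exact: perm_inj.
- by move=> _ /mapP[x xz ->]; rewrite permK fz.
- by rewrite -[RHS]sf [RHS](reindex_inj (@perm_inj _ (r^-1)%g)).
Qed.

(** The first [N + N] steps only transport [z] and [f]; [matching_steps] then applies to the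
    transported data, and the spreading of pairs bounds the mean energy it removes. *)
Lemma round_contracts z f : admissible k z f ->
  (\sum_b f b * ipm (N + N + N) (fun r => H (r b) (map r z))) ^+ 2 <=
  215 / 216 * C * \sum_b f b ^+ 2.
Proof.
move=> adm.
have -> : \sum_b f b * ipm (N + N + N) (fun r => H (r b) (map r z)) =
  ipm (N + N) (fun s => \sum_b f (s^-1%g b) *
     ipm N (fun r => H (r b) (map r (map s z)))).
  transitivity (ipm (N + N) (fun s => \sum_b f b *
     ipm N (fun r => H (r (s b)) (map r (map s z))))).
    rewrite (mean_sum mNN); apply: eq_bigr => b _.
    rewrite (ip_meanD x0 h_ge0 h_small (N + N)); congr (_ * ip_mean _ _ _ _); apply/funext => s.
    congr ip_mean; apply/funext => r; rewrite permM; congr H.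
    by rewrite -map_comp; apply: eq_map => x /=; rewrite permM.
  congr ip_mean; apply/funext => s.
  rewrite [RHS](reindex_inj (@perm_inj _ s)) /=; apply: eq_bigr => b _.
  by rewrite permK.
apply: le_trans (mean_sqr mNN _) _.
set S := \sum_b f b ^+ 2.
set n : R := #|G|%:R.
have n2 : 2 <= n by rewrite (ler_nat _ 2); lia.
(* For a fixed outcome [s] of the first phase, the pairs are indexed by their initial vertices, so
   that only [pair_gain] depends on [s]. *)
have bound (s : {perm G}) : (\sum_b f (s^-1%g b) * ipm N (fun r => H (r b) (map r (map s z)))) ^+ 2 <=
   - (C / 2) * (\sum_q pair_energy z f q.1 q.2 * pair_gain (s q.1) (s q.2)) + C * S.
  have := matching_steps (admissible_perm s adm).
  have -> : \sum_b f (s^-1%g b) ^+ 2 = S by rewrite /S [RHS](reindex_inj (@perm_inj _ s^-1%g)).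
  rewrite mean_gainE pair_bigA /=.
  have s2_inj : injective (fun q : G * G => (s q.1, s q.2)).
    by move=> [a b] [c d] [/perm_inj -> /perm_inj ->].
  rewrite [X in _ - X / 2](reindex_inj s2_inj) /=.
  rewrite (eq_bigr (fun q => pair_energy z f q.1 q.2 * pair_gain (s q.1) (s q.2))); last first.
    by move=> q _; rewrite /pair_energy !permK !mem_map //; exact: perm_inj.
  set X := \sum_q _; set Y := _ ^+ 2; lra.
apply: le_trans (mean_le mNN (fun s _ => bound s)) _.
rewrite (mean_lin mNN) (mean_const mNN) (mean_sum mNN).
set X := \sum_q _.
(* Half of this loss, [C * S / 216], turns [C] into [215 / 216 * C]. *)
suff hX : S / 108 <= X by have := ler_wpM2l C_ge0 hX; lra.
set T := \sum_a \sum_b (a != b)%:R * pair_gain a b.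
have e0 q : 0 <= pair_energy z f q.1 q.2.
  by rewrite /pair_energy; case: ifP => // _; exact: sqr_ge0.
have : \sum_(q : G * G) pair_energy z f q.1 q.2 * (T / (3 * n ^+ 2)) <= X.
  apply: ler_sum => [[v w]] _ /=; have [<-|vw] := eqVneq v w.
    by rewrite /pair_energy subrr expr0n /=; case: ifP; rewrite !mul0r.
  by apply: (ler_wpM2l (e0 (v, w))); apply: pair_spread => // a b; exact: pair_gain_ge0.
have [uz sz fz sf] := adm.
have : \sum_(q : G * G) pair_energy z f q.1 q.2 = 2 * (n - k%:R) * S.
  by rewrite -sz -sum_pairs_out // pair_bigA.
rewrite -mulr_suml => -> XX.
apply: le_trans XX.
have kn : 2 * k%:R <= n - 2 by rewrite lerBrDr -natrM -natrD ler_nat; lia.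
have S0 : 0 <= S by apply: sumr_ge0 => b _; exact: sqr_ge0.
have T0 : n / 36 <= T := total_gain.
(* Here 108 = 36 * 3. The total energy [2 * (n - k%:R) * S] is at least [n * S], which leaves
   [S / 108]. *)
have T1 : (108 * n)^-1 <= T / (3 * n ^+ 2).
  rewrite ler_pdivlMr ?mulr_gt0 ?exprn_gt0 //; try lra.
  by apply: le_trans T0; rewrite le_eqVlt; apply/orP; left; apply/eqP; field; lra.
have : n * S <= 2 * (n - k%:R) * S by apply: ler_wpM2r => //; lra.
have -> : S / 108 = (n * S) * (108 * n)^-1 by field; lra.
move=> h1; apply: ler_pM => //; first by apply: mulr_ge0 => //; lra.
by rewrite invr_ge0; lra.
Qed.

End Round.

(** The first round is peeled off and the mean over the other [j] rounds serves as [H]; with no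
    round left it is the Cauchy-Schwarz inequality. *)
Lemma rounds_contract (F : G -> seq G -> R) j z f :
  (forall b y, `|F b y| <= 1) -> admissible k z f ->
  (\sum_b f b * ipm (j * (N + N + N)) (fun r => F (r b) (map r z))) ^+ 2 <=
  (215 / 216) ^+ j * #|G|%:R * \sum_b f b ^+ 2.
Proof.
move=> F1; elim: j z f => [|j IH] z f adm.
  have := sum_sqr_le (fun b => f b * F b z).
  rewrite expr0 mul1r mul0n.
  have -> : \sum_b f b * ipm 0 (fun r => F (r b) (map r z)) = \sum_b f b * F b z.
    apply: eq_bigr => b _; rewrite ip_mean0 perm1.
    by rewrite (eq_map (@perm1 G)) map_id.
  move=> /le_trans; apply; apply: ler_wpM2l => //; apply: ler_sum => b _.
  rewrite exprMn -[X in _ <= X]mulr1; apply: ler_wpM2l; first exact: sqr_ge0.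
  by rewrite -real_normK ?num_real // expr_le1.
have C0 : 0 <= (215 / 216) ^+ j * #|G|%:R :> R.
  by apply: mulr_ge0 => //; apply: exprn_ge0; lra.
have := round_contracts C0 IH adm.
have -> : \sum_b f b * ipm (j.+1 * (N + N + N)) (fun r => F (r b) (map r z)) =
   \sum_b f b * ipm (N + N + N) (fun s => ipm (j * (N + N + N))
      (fun r => F (r (s b)) (map r (map s z)))).
  apply: eq_bigr => b _; rewrite mulSn (ip_meanD x0 h_ge0 h_small (N + N + N)).
  congr (_ * ip_mean _ _ _ _); apply/funext => s; congr ip_mean; apply/funext => r.
  rewrite permM; congr F.
  by rewrite -map_comp; apply: eq_map => x /=; rewrite permM.
by rewrite [in X in _ -> X](exprS (215 / 216)) !mulrA.
Qed.

(** When two configurations differ in one entry, the contraction is applied to the difference of the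
    point masses at [a] and [b], of squared norm 2, the other entries being black. *)
Lemma ip_mean_oscillation (F : seq G -> R) j x y :
  (forall s, `|F s| <= 1) -> uniq x -> uniq y -> size x = k.+1 -> size y = k.+1 ->
  `|ipm (j * (N + N + N)) (fun r => F (map r x)) -
    ipm (j * (N + N + N)) (fun r => F (map r y))| <=
  2 * k.+1%:R * Num.sqrt (2 * #|G|%:R * (215 / 216) ^+ j).
Proof.
move=> F1; apply: (@one_change_chain _ _ _ (fun x => ipm (j * (N + N + N)) (fun r => F (map r x)))).
- exact: sqrtr_ge0.
- lia.
move=> s1 a b s2 ua ub sa /=.
have [<-|ab] := eqVneq a b; first by rewrite subrr normr0 sqrtr_ge0.
pose z := s1 ++ s2.
pose i := size s1.
pose f c : R := (c == a)%:R - (c == b)%:R.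
have piv c : uniq (s1 ++ c :: s2) = (c \notin z) && uniq z.
  by rewrite -cat1s uniq_catCA.
move: ua ub; rewrite !piv => /andP[az uz] /andP[bz _].
have sum_f (g : G -> R) : \sum_c f c * g c = g a - g b.
  have ba : b != a by rewrite eq_sym.
  rewrite (bigD1 a) //= (bigD1 b) //= big1 => [|c /andP[/negbTE ca /negbTE cb]].
    by rewrite /f !eqxx (negbTE ab) (negbTE ba) /=; ring.
  by rewrite /f ca cb /=; ring.
have adm : admissible k z f.
  split=> //.
  - by move: sa; rewrite /z !size_cat /= addnS => -[].
  - move=> c cz; rewrite /f.
    have -> : (c == a) = false by apply: contraNF az => /eqP <-.
    have -> : (c == b) = false by apply: contraNF bz => /eqP <-.
    by rewrite subrr.
  - transitivity (\sum_c f c * 1); first by apply: eq_bigr => c _; rewrite mulr1.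
    by rewrite (sum_f (fun=> 1)) subrr.
(* The last particle is put back at its place [i] among the black ones. *)
have := @rounds_contract (fun c z => F (take i z ++ c :: drop i z)) j z f (fun _ _ => F1 _) adm.
rewrite sum_f.
have E c : (fun r : {perm G} => F (take i (map r z) ++ r c :: drop i (map r z))) =
           (fun r : {perm G} => F (map r (s1 ++ c :: s2))).
  apply/funext => r; rewrite -map_take -map_drop /z take_size_cat // drop_size_cat //.
  by rewrite map_cat.
rewrite !E.
have -> : \sum_c f c ^+ 2 = 2.
  transitivity (\sum_c f c * f c) => //.
  have ba : (b == a) = false by rewrite eq_sym; apply/negbTE.
  by rewrite sum_f /f !eqxx ba (negbTE ab) /=; ring.
set D := _ - _; move=> bound.
rewrite -sqrtr_sqr; apply: ler_wsqrtr; apply: le_trans bound _.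
by rewrite le_eqVlt; apply/orP; left; apply/eqP; ring.
Qed.

End Contraction.

(** * Discretization of the exponential *)

Section MatrixExponential.
Variables (R : realType) (n : nat) (A : 'M[R]_n).

Let C : R := \sum_i \sum_j `|A i j|.

Lemma mxpow_entry_bound m i j : `|(A ^+ m) i j| <= C ^+ m.
Proof.
elim: m i j => [|m IH] i j.
  rewrite !expr0 mxE; case: (i == j) => /=; first by rewrite normr1.
  by rewrite normr0 ler01.
have C0 : 0 <= C by apply: sumr_ge0 => x _; apply: sumr_ge0 => y _.
rewrite exprS mxE; apply: le_trans (ler_norm_sum _ _ _) _.
apply: (@le_trans _ _ (\sum_l `|A i l| * C ^+ m)).
  by apply: ler_sum => l _; rewrite normrM ler_wpM2l.
rewrite -mulr_suml exprS ler_wpM2r ?exprn_ge0 //.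
rewrite /C [X in _ <= X](bigD1 i) //= lerDl.
by apply: sumr_ge0 => x _; apply: sumr_ge0.
Qed.

Lemma scalemx_exp (a : R) m : (a *: A) ^+ m = a ^+ m *: A ^+ m.
Proof.
elim: m => [|m IH]; first by rewrite !expr0 scale1r.
by rewrite !exprS IH -[LHS]/((a *: A) *m (_ *: _)) -scalemxAl -scalemxAr scalerA.
Qed.

(** The ratio is the product of the factors [1 - i / N] for [i < m]. *)
Lemma ffact_ratio (N m : nat) : (0 < N)%N -> (m <= N)%N ->
  1 - m%:R ^+ 2 / N%:R <= (N ^_ m)%:R / N%:R ^+ m :> R /\ (N ^_ m)%:R / N%:R ^+ m <= 1 :> R.
Proof.
move=> N0; have NR : 0 < N%:R :> R by rewrite ltr0n.
elim: m => [|m IH] mN; first by rewrite ffactn0 expr0 divr1 mulr0n expr0n /= mul0r subr0.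
have [IH1 IH2] := IH (ltnW mN).
have -> : (N ^_ m.+1)%:R / N%:R ^+ m.+1 = (N ^_ m)%:R / N%:R ^+ m * (1 - m%:R / N%:R) :> R.
  rewrite ffactnSr natrM natrB 1?ltnW // exprS invfM.
  by field; rewrite expf_neq0 ?gt_eqF.
set q := (N ^_ m)%:R / N%:R ^+ m in IH1 IH2 *; set N' : R := N%:R in IH1 NR *.
have q0 : 0 <= q by apply: divr_ge0 => //; apply: exprn_ge0; lra.
have m1 : m%:R / N' <= 1 by rewrite ler_pdivrMr // mul1r ler_nat ltnW.
have m0 : 0 <= m%:R / N' :> R by apply: divr_ge0 => //; lra.
split; last by nra.
have e : m.+1%:R ^+ 2 / N' = m%:R ^+ 2 / N' + m%:R / N' + m.+1%:R / N' :> R.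
  by rewrite -natr1 -!mulrDl; congr (_ / _); ring.
have : 0 <= m.+1%:R / N' :> R by apply: divr_ge0 => //; lra.
have : q * (m%:R / N') <= m%:R / N' by apply: ler_piMl.
by rewrite e; move: IH1; lra.
Qed.

Definition euler_step N : 'M[R]_n := 1 + N.+1%:R^-1 *: A.

Lemma euler_entry N i j : (euler_step N ^+ N.+1) i j =
  \sum_(m < N.+2) (N.+1 ^_ m)%:R / N.+1%:R ^+ m * ((A ^+ m) i j / m`!%:R).
Proof.
rewrite /euler_step exprDn_comm; last by apply/commr_sym; exact: commr1.
rewrite summxE; apply: eq_bigr => m _.
rewrite expr1n mul1r scalemx_exp mulmxnE mxE -mulr_natr exprVn.
rewrite -bin_ffact natrM.
have : m`!%:R != 0 :> R by rewrite pnatr_eq0 -lt0n fact_gt0.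
move=> f0; by field; rewrite f0 expf_neq0 // pnatr_eq0.
Qed.

Let coeff i j (m : nat) := (A ^+ m) i j / m`!%:R.

Lemma coeff_bound i j m : `|coeff i j m| <= exp_coeff C m.
Proof.
rewrite /coeff normrM normfV (ger0_norm (ler0n _ _)) /exp_coeff.
by apply: ler_wpM2r (mxpow_entry_bound _ _ _); rewrite invr_ge0.
Qed.

Let C0 : 0 <= C.
Proof. by apply: sumr_ge0 => x _; apply: sumr_ge0 => y _. Qed.

Lemma expmx_cvg i j : series (coeff i j) @ \oo --> expmx A i j.
Proof.
rewrite /expmx mxE; apply: normed_cvg.
apply: (series_le_cvg _ _ (coeff_bound i j)); first by move=> m /=.
- by move=> m; apply: exp_coeff_ge0.
- exact: is_cvg_series_exp_coeff.
Qed.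

(** Term [m] of the binomial expansion has relative error at most [m ^ 2 / N.+1], and
    [m ^ 2 <= 4 ^ m] is absorbed by replacing [C] with [4 * C]. *)
Lemma euler_error i j N :
  `|series (coeff i j) N.+2 - (euler_step N ^+ N.+1) i j| <= expR (4 * C) * N.+1%:R^-1.
Proof.
rewrite euler_entry /series /= big_mkord -sumrB.
apply: le_trans (ler_norm_sum _ _ _) _.
have : \sum_(m < N.+2) exp_coeff (4 * C) m <= expR (4 * C).
  rewrite -(big_mkord xpredT (exp_coeff (4 * C))).
  apply: (nondecreasing_cvgn_le (u_ := series (exp_coeff (4 * C)))).
    apply/nondecreasing_series => m _ _; apply: exp_coeff_ge0.
    by rewrite mulr_ge0.
  exact: is_cvg_series_exp_coeff.
rewrite -(ler_pM2r (x := N.+1%:R^-1)) ?invr_gt0 ?ltr0n // mulr_suml.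
apply: le_trans; apply: ler_sum => m _.
have [r1 r2] := @ffact_ratio N.+1 m isT (ltn_ord m).
rewrite -/(coeff i j m) -{1}[coeff i j m]mul1r -mulrBl normrM ger0_norm ?subr_ge0 //.
have cb := coeff_bound i j m.
apply: (@le_trans _ _ (m%:R ^+ 2 / N.+1%:R * exp_coeff C m)).
  apply: ler_pM => //; first by rewrite subr_ge0.
  by rewrite lerBlDr addrC -lerBlDr.
have -> : exp_coeff (4 * C) m = 4 ^+ m * exp_coeff C m by rewrite /exp_coeff /= exprMn mulrA.
rewrite mulrAC ler_wpM2r ?invr_ge0 // ler_wpM2r ?exp_coeff_ge0 //.
rewrite -!natrX ler_nat (_ : 4 = 2 ^ 2)%N //.
by rewrite -expnM mulnC expnM leq_sqr ltnW // ltn_expl.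
Qed.

Lemma euler_cvg i j : (fun N => (euler_step N ^+ N.+1) i j) @ \oo --> expmx A i j.
Proof.
have c2 : (fun N => series (coeff i j) N.+2) @ \oo --> expmx A i j.
  have := @expmx_cvg i j; rewrite -(cvg_shiftS (series _)).
  by rewrite -(cvg_shiftS (fun N => series _ N.+1)).
have ce : (fun N => expR (4 * C) * N.+1%:R^-1) @ \oo --> (0 : R).
  by rewrite -(mulr0 (expR (4 * C))); apply: cvgM; [exact: cvg_cst | exact: cvg_harmonic].
have cd : (fun N => series (coeff i j) N.+2 - (euler_step N ^+ N.+1) i j) @ \oo --> (0 : R).
  apply: norm_cvg0.
  apply: (@squeeze_cvgr _ _ _ _ (fun=> 0) (fun N => expR (4 * C) * N.+1%:R^-1)).
  - by near=> N; rewrite normr_ge0 euler_error.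
  - exact: cvg_cst.
  - exact: ce.
rewrite -[expmx A i j]subr0.
have -> : (fun N => (euler_step N ^+ N.+1) i j) =
  (fun N => series (coeff i j) N.+2 -
     (series (coeff i j) N.+2 - (euler_step N ^+ N.+1) i j)).
  by apply/funext => N; rewrite opprB addrC subrK.
exact: cvgB c2 cd.
Unshelve. all: by end_near.
Qed.

End MatrixExponential.

(** The step size depends on [t] and [N] alone, so one discretization serves every multiple of [t],
    as the rounds require. *)
Lemma euler_cvg_multiple (R : realType) n (A : 'M[R]_n) (c : nat) (t : R) i j :
  (0 < c)%N ->
  (fun N => ((1 + (t / N.+1%:R) *: A) ^+ (c * N.+1)) i j) @ \oo -->
    expmx ((c%:R * t) *: A) i j.
Proof.
move=> c0; set B := (c%:R * t) *: A.
have step N : ((1 + (t / N.+1%:R) *: A) ^+ (c * N.+1)) =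
    euler_step B (c * N.+1).-1 ^+ (c * N.+1).-1.+1.
  have cN : (0 < c * N.+1)%N by rewrite muln_gt0 c0.
  rewrite /euler_step (prednK cN); congr ((_ + _) ^+ _).
  rewrite /B scalerA natrM invfM; congr (_ *: A).
  have : c%:R != 0 :> R by rewrite pnatr_eq0 -lt0n.
  by move=> h; field; rewrite h addrC natr1 pnatr_eq0.
have cy : (fun N => (c * N.+1).-1) @ \oo --> \oo.
  apply/cvgnyPge => M; exists M => // N /= MN.
  by apply: leq_trans MN _; rewrite -ltnS prednK ?muln_gt0 ?c0 // leq_pmull.
have := cvg_comp _ _ cy (@euler_cvg _ _ B i j).
by under [X in X @ _ --> _ -> _]funext => N do rewrite /= -step.
Qed.

Lemma cvg_sum (R : realType) (I : finType) (F : I -> nat -> R) (l : I -> R) :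
  (forall i, F i @ \oo --> l i) -> (fun N => \sum_i F i N) @ \oo --> \sum_i l i.
Proof. by move=> h; apply: cvg_big => //; exact: add_continuous. Qed.

(** * Finite chains: total variation, uniqueness of the stationary distribution, minorization *)

Section Chains.
Variables (R : realType) (S : finType).
Implicit Types (p q r : S -> R) (A : {set S}).

Lemma sum_enum_rank (F : 'I_#|S| -> R) : \sum_i F i = \sum_s F (enum_rank s).
Proof.
by apply: reindex; apply: onW_bij; exists enum_val; [exact: enum_rankK|exact: enum_valK].
Qed.

Lemma dTV_leP p q (delta : R) : 0 <= delta ->
  dTV p q <= delta <-> forall A, \sum_(s in A) p s - \sum_(s in A) q s <= delta.
Proof.
move=> d0; split=> [h A|h].
  apply: le_trans h; rewrite /dTV.
  exact: (le_bigmax _ (fun A : {set S} => \sum_(s in A) p s - \sum_(s in A) q s)).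
by apply: bigmax_le => // A _.
Qed.

Lemma sum_setC_sub p q A : \sum_s p s = \sum_s q s ->
  \sum_(s in ~: A) (q s - p s) = \sum_(s in A) (p s - q s).
Proof.
move=> pq; have : \sum_s (p s - q s) = 0 by rewrite sumrB pq subrr.
rewrite (bigID (mem A)) /= => /eqP; rewrite addr_eq0 => /eqP ->.
rewrite -sumrN; apply: eq_big => [s|s _]; rewrite ?finset.inE //.
by rewrite opprB.
Qed.

Lemma l1_le_dTV p q (delta : R) : \sum_s p s = \sum_s q s -> 0 <= delta ->
  dTV p q <= delta -> \sum_s `|p s - q s| <= 2 * delta.
Proof.
move=> pq d0 /(dTV_leP _ _ d0) h.
set A := [set s | q s <= p s]%SET.
have hA := h A; rewrite -sumrB in hA.
have E : \sum_s `|p s - q s| = \sum_(s in A) (p s - q s) + \sum_(s in ~: A) (q s - p s).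
  rewrite (bigID (mem A)) /=; congr (_ + _).
    by apply: eq_bigr => s; rewrite finset.inE => h1; rewrite ger0_norm ?subr_ge0.
  apply: eq_big => s; rewrite ?finset.inE // -ltNge => h1.
  by rewrite ltr0_norm ?opprB // subr_lt0.
by rewrite E sum_setC_sub //; lra.
Qed.

(** On functions of total mass 0 the kernel contracts the L1 norm by [2 * delta < 1], as [r] may be
    subtracted from every row; [p - q] is fixed by it. *)
Lemma stationary_unique (k : S -> S -> R) r p q (delta : R) :
  0 <= delta -> delta < 1 / 2 ->
  (forall s, \sum_s' k s s' = 1) -> \sum_s r s = 1 ->
  (forall s, dTV (k s) r <= delta) ->
  \sum_s p s = 1 -> \sum_s q s = 1 ->
  (forall s', \sum_s p s * k s s' = p s') -> (forall s', \sum_s q s * k s s' = q s') ->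
  p = q.
Proof.
move=> d0 d12 k1 r1 kr p1 q1 pk qk.
set g := fun s => p s - q s.
have g0 : \sum_s g s = 0 by rewrite sumrB p1 q1 subrr.
have gE s' : g s' = \sum_s g s * (k s s' - r s').
  rewrite /g -pk -qk -sumrB.
  transitivity (\sum_s (g s * (k s s' - r s') + g s * r s')).
    by apply: eq_bigr => s _; rewrite /g; ring.
  by rewrite big_split /= -mulr_suml g0 mul0r addr0.
have : \sum_s' `|g s'| <= 2 * delta * \sum_s `|g s|.
  apply: (@le_trans _ _ (\sum_s' \sum_s `|g s| * `|k s s' - r s'|)).
    apply: ler_sum => s' _; rewrite {1}gE; apply: le_trans (ler_norm_sum _ _ _) _.
    by apply: ler_sum => s _; rewrite normrM.
  rewrite exchange_big mulr_sumr; apply: ler_sum => s _ /=.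
  rewrite -mulr_sumr mulrC ler_wpM2r //.
  by apply: l1_le_dTV => //; rewrite k1 r1.
have : 0 <= \sum_s `|g s| by apply: sumr_ge0.
set T := \sum_s _ => T0 hT.
have : T = 0 by nra.
move=> /eqP; rewrite psumr_eq0 // => /allP h; apply/funext => s.
by have := h s (mem_index_enum s); rewrite normr_eq0 subr_eq0 => /eqP.
Qed.

(** Truncated at w = 1/|S|, each row keeps mass at least 2/3. For a, b at most w one has
    [a * b >= w * (a + b - w)], and summing gives w (2/3 + 2/3 - 1) = w/3. *)
Lemma square_minorized (k : S -> S -> R) :
  (forall x y, k x y = k y x) -> (forall x, \sum_y k x y = 1) ->
  (forall x y, 0 <= k x y) ->
  (forall x A, \sum_(y in A) k x y - #|A|%:R / #|S|%:R <= 1 / 3) ->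
  forall x y, (3 * #|S|%:R)^-1 <= \sum_u k x u * k u y.
Proof.
move=> sym k1 k0 kA x y.
have Spos : 0 < #|S|%:R :> R by rewrite ltr0n; apply/card_gt0P; exists x.
pose w : R := #|S|%:R^-1.
pose m v u := Num.min (k v u) w.
have w0 : 0 < w by rewrite invr_gt0.
have msum v : 2 / 3 <= \sum_u m v u.
  have := kA v [set u | w <= k v u]%SET; set A := [set u | _]%SET.
  have -> : #|A|%:R / #|S|%:R = \sum_(u in A) w :> R by rewrite sumr_const mulr_natl.
  rewrite -sumrB => h.
  have : \sum_u (k v u - m v u) = \sum_(u in A) (k v u - w).
    rewrite [RHS]big_mkcond; apply: eq_bigr => u _; rewrite finset.inE /m.
    by case: leP => h1; rewrite ?subrr.
  by rewrite sumrB k1; lra.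
apply: (@le_trans _ _ (\sum_u w * (m x u + m y u - w))).
  have wS : \sum_(u : S) w = 1 by rewrite sum_const mulfV // gt_eqF.
  rewrite -mulr_sumr sumrB big_split /= wS invfM -/w.
  have := msum x; have := msum y; nra.
apply: ler_sum => u _; rewrite [k u y]sym.
have : 0 <= m x u by rewrite le_min k0 ltW.
have : 0 <= m y u by rewrite le_min k0 ltW.
have : m x u <= k x u by rewrite ge_min lexx.
have : m y u <= k y u by rewrite ge_min lexx.
have : m x u <= w by rewrite ge_min lexx orbT.
have : m y u <= w by rewrite ge_min lexx orbT.
move: (m x u) (m y u) => a b hb ha hb' ha' b0 a0.
apply: (@le_trans _ _ (a * b)); first by nra.
exact: ler_pM.
Qed.

End Chains.

(** * The interchange process *)

Section Interchange.
Variables (R : realType) (G : weighted_graph R) (x0 : G) (k : nat).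
Local Notation S := (config G k).
Local Notation rate := (@ip_rate R G k).
Local Notation Q := (generator rate).
Implicit Types (x y : S) (g : S -> R) (r s : {perm G}).

Lemma perm_config1 x : perm_config 1%g x = x.
Proof.
by apply/val_inj/val_inj; rewrite /= (eq_map (@perm1 G)) map_id.
Qed.

Lemma perm_configM s r x : perm_config (s * r)%g x = perm_config r (perm_config s x).
Proof.
apply/val_inj/val_inj; rewrite /= -map_comp; apply: eq_map => v /=.
by rewrite permM.
Qed.

Lemma perm_configK s : cancel (perm_config (k := k) s) (perm_config s^-1%g).
Proof. by move=> x; rewrite -perm_configM mulgV perm_config1. Qed.

Lemma edge_swapK (e : {set G}) : (edge_swap e)^-1%g = edge_swap e.
Proof. by rewrite (edge_swap_ends x0) tpermV. Qed.

Lemma ip_rate_sym x y : rate x y = rate y x.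
Proof.
rewrite /ip_rate; apply: eq_bigl => e; congr (_ && _).
apply/eqP/eqP => <-; rewrite -{1}(edge_swapK e) perm_configK //.
Qed.

Lemma generator_sym : Q^T = Q.
Proof.
apply/matrixP => i j; rewrite !mxE eq_sym; case: eqVneq => [->|] //.
by rewrite ip_rate_sym.
Qed.

Lemma trmx_exp n (A : 'M[R]_n) m : (A ^+ m)^T = (A^T) ^+ m.
Proof.
elim: m => [|m IH]; first by rewrite !expr0 trmx1.
by rewrite exprS exprSr -IH; exact: trmx_mul.
Qed.

Section Discrete.
Variable h : R.
Hypotheses (h_ge0 : 0 <= h) (h_small : 2 * h * total_weight G <= 1).

Definition step_mx : 'M[R]_#|{: S}| := 1 + h *: Q.

Lemma step_mx_sym M : (step_mx ^+ M)^T = step_mx ^+ M.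
Proof. by rewrite trmx_exp /step_mx linearD linearZ /= trmx1 generator_sym. Qed.

Lemma step_mx_apply x g :
  \sum_y step_mx (enum_rank x) (enum_rank y) * g y =
  (1 - h * total_weight G) * g x +
  \sum_(e in edges G) h * weight e * g (perm_config (edge_swap e) x).
Proof.
rewrite (bigD1 x) //= /step_mx !mxE !eqxx enum_rankK /=.
have -> : \sum_(y | y != x) (1 + h *: Q) (enum_rank x) (enum_rank y) * g y =
    \sum_(y | y != x) h * (rate x y * g y).
  apply: eq_bigr => y yx; rewrite !mxE !enum_rankK (inj_eq enum_rank_inj).
  by rewrite [x == y]eq_sym (negbTE yx) /=; ring.
transitivity (g x + h * \sum_y rate x y * (g y - g x)).
  rewrite [X in _ = _ + h * X](bigD1 x) //= subrr mulr0 add0r.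
  have -> : \sum_(i | i != x) rate x i * (g i - g x) =
     \sum_(i | i != x) rate x i * g i - (\sum_(i | i != x) rate x i) * g x.
    by rewrite mulr_suml -sumrB; apply: eq_bigr => y _; ring.
  rewrite -mulr_sumr; set a := \sum_(_ | _) _ * _; set b := \sum_(_ | _) _; ring.
have -> : \sum_y rate x y * (g y - g x) =
    \sum_(e in edges G) weight e * (g (perm_config (edge_swap e) x) - g x).
  rewrite /ip_rate.
  under eq_bigr => y _ do rewrite mulr_suml big_mkcondr /=.
  rewrite exchange_big /=; apply: eq_bigr => e _.
  rewrite (bigD1 (perm_config (edge_swap e) x)) //= eqxx big1 ?addr0 // => y.
  by rewrite eq_sym => /negbTE ->.
have -> : \sum_(e in edges G) weight e * (g (perm_config (edge_swap e) x) - g x) =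
  \sum_(e in edges G) weight e * g (perm_config (edge_swap e) x) - total_weight G * g x.
  by rewrite /total_weight mulr_suml -sumrB; apply: eq_bigr => e _; ring.
have -> : \sum_(e in edges G) h * weight e * g (perm_config (edge_swap e) x) =
  h * \sum_(e in edges G) weight e * g (perm_config (edge_swap e) x).
  by rewrite mulr_sumr; apply: eq_bigr => e _; ring.
by ring.
Qed.

Lemma step_mx_mean M x g :
  \sum_y (step_mx ^+ M) (enum_rank x) (enum_rank y) * g y =
  ip_mean x0 h M (fun r => g (perm_config r x)).
Proof.
elim: M x => [|M IH] x.
  rewrite ip_mean0 perm_config1 (bigD1 x) //= expr0 mxE eqxx mul1r big1 ?addr0 // => y yx.
  by rewrite mxE (inj_eq enum_rank_inj) eq_sym (negbTE yx) mul0r.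
rewrite ip_meanS // exprS.
transitivity (\sum_u step_mx (enum_rank x) (enum_rank u) *
    ip_mean x0 h M (fun r => g (perm_config r u))).
  under eq_bigr => y _ do rewrite mxE sum_enum_rank mulr_suml.
  rewrite exchange_big; apply: eq_bigr => u _; rewrite -IH mulr_sumr.
  by apply: eq_bigr => y _; rewrite mulrA.
rewrite step_mx_apply; congr (_ + _); apply: eq_bigr => e _; congr (_ * ip_mean _ _ _ _).
by apply/funext => r; rewrite perm_configM.
Qed.

End Discrete.

Definition evolve t x g : R := \sum_y transition rate t x y * g y.

Lemma small_steps (t : R) : 0 <= t ->
  \forall N \near \oo, 0 <= t / N.+1%:R /\ 2 * (t / N.+1%:R) * total_weight G <= 1.
Proof.
move=> t0.
have W0 : 0 <= total_weight G by apply: sumr_ge0 => e /weight_gt0/ltW.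
exists (Num.truncn (2 * t * total_weight G)) => // N /= hN; split.
  exact: divr_ge0.
rewrite mulrA mulrAC ler_pdivrMr // mul1r.
apply: le_trans (ltW (truncnS_gt _)) _.
by rewrite ler_nat.
Qed.

Lemma evolve_cvg (c : nat) t x g : 0 <= t -> (0 < c)%N ->
  (fun N => ip_mean x0 (t / N.+1%:R) (c * N.+1) (fun r => g (perm_config r x)))
    @ \oo --> evolve (c%:R * t) x g.
Proof.
move=> t0 c0.
have : (fun N => \sum_y (step_mx (t / N.+1%:R) ^+ (c * N.+1)) (enum_rank x) (enum_rank y) * g y)
    @ \oo --> evolve (c%:R * t) x g.
  apply: cvg_sum => y; apply: cvgMl; exact: euler_cvg_multiple.
apply: cvg_trans; apply: near_eq_cvg.
have := small_steps t0; apply: filterS => N [h0 h1].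
by rewrite step_mx_mean.
Qed.

End Interchange.

(** * The uniform distribution is stationary *)

Section Stationary.
Variables (R : realType) (G : weighted_graph R) (x0 : G) (k : nat).
Local Notation S := (config G k).
Local Notation rate := (@ip_rate R G k).
Local Notation unif := (fun _ : S => #|S|%:R^-1 : R).
Implicit Types (x y : S) (g : S -> R) (A : {set S}).

Lemma evolve_cvg1 t x g : 0 <= t ->
  (fun N => ip_mean x0 (t / N.+1%:R) N.+1 (fun r => g (perm_config r x)))
    @ \oo --> evolve t x g.
Proof.
move=> t0; have := @evolve_cvg _ _ x0 k 1 t x g t0 isT; rewrite mul1r.
by under [X in X @ _ --> _ -> _]funext => N do rewrite mul1n.
Qed.

Lemma evolve_const t x (c : R) : 0 <= t -> evolve t x (fun=> c) = c.
Proof.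
move=> t0; have E : \forall N \near \oo, ip_mean x0 (t / N.+1%:R) N.+1 (fun r => c) = c.
  have := small_steps G t0; apply: filterS => N [h0 h1].
  exact: (mean_const (ip_mean_is_mean x0 h0 h1 _)).
apply/eqP; rewrite eq_le; apply/andP; split.
  by apply: (cvgr_to_le (@evolve_cvg1 t x (fun=> c) t0)); apply: filterS E => N ->.
by apply: (cvgr_to_ge (@evolve_cvg1 t x (fun=> c) t0)); apply: filterS E => N ->.
Qed.

(** Each permutation of the vertices acts bijectively on configurations, so the discrete means
    preserve the sum, and so does the limit. *)
Lemma sum_evolve t g : 0 <= t -> \sum_x evolve t x g = \sum_x g x.
Proof.
move=> t0.
have cv : (fun N => \sum_x ip_mean x0 (t / N.+1%:R) N.+1 (fun r => g (perm_config r x)))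
    @ \oo --> \sum_x evolve t x g.
  by apply: cvg_sum => x; exact: evolve_cvg1.
have E : \forall N \near \oo,
    \sum_x ip_mean x0 (t / N.+1%:R) N.+1 (fun r => g (perm_config r x)) = \sum_x g x.
  have := small_steps G t0; apply: filterS => N [h0 h1].
  have mN := ip_mean_is_mean x0 h0 h1 N.+1.
  rewrite -[RHS](mean_const mN).
  transitivity (\sum_x 1 * ip_mean x0 (t / N.+1%:R) N.+1 (fun r => g (perm_config r x))).
    by apply: eq_bigr => x _; rewrite mul1r.
  rewrite -(mean_sum mN); congr ip_mean; apply/funext => r.
  rewrite [RHS](reindex_inj (can_inj (perm_configK r))).
  by apply: eq_bigr => x _; rewrite mul1r.
apply/eqP; rewrite eq_le; apply/andP; split.
  by apply: (cvgr_to_le cv); apply: filterS E => N ->.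
by apply: (cvgr_to_ge cv); apply: filterS E => N ->.
Qed.

Lemma transition_sum t x A :
  \sum_(y in A) transition rate t x y = evolve t x (fun y => (y \in A)%:R).
Proof.
rewrite /evolve big_mkcond; apply: eq_bigr => y _.
by case: (y \in A); rewrite ?mulr1 ?mulr0.
Qed.

Lemma transition_total t x : 0 <= t -> \sum_y transition rate t x y = 1.
Proof.
move=> t0; rewrite -[RHS](evolve_const x 1 t0).
by apply: eq_bigr => y _; rewrite mulr1.
Qed.

Hypothesis k_le : (k <= #|G|)%N.

Lemma config_gt0 : (0 < #|{: S}|)%N.
Proof.
have st : size (take k (enum G)) == k by rewrite size_takel // -cardE.
have ut : uniq (Tuple st) by apply: take_uniq; exact: enum_uniq.
by apply/card_gt0P; exists (exist _ (Tuple st) ut).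
Qed.

Let S0 : #|{: S}|%:R != 0 :> R.
Proof. by rewrite pnatr_eq0 -lt0n config_gt0. Qed.

Lemma unif_total : \sum_(x : S) #|S|%:R^-1 = 1 :> R.
Proof. by rewrite sum_const mulfV. Qed.

Lemma uniform_stationary : is_stationary rate unif.
Proof.
split=> [x||t t0 y]; first by rewrite invr_ge0.
- exact: unif_total.
- rewrite -mulr_sumr -[RHS]mulr1; congr (_ * _).
  transitivity (\sum_x evolve t x (fun y' => (y' == y)%:R)).
    apply: eq_bigr => x _; rewrite /evolve (bigD1 y) //= eqxx mulr1 big1 ?addr0 //.
    by move=> i /negbTE ->; rewrite mulr0.
  rewrite sum_evolve // (bigD1 y) //= eqxx big1 ?addr0 // => i /negbTE -> //.
Qed.

Lemma stationary_distP : is_stationary rate (stationary_dist rate).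
Proof. by apply: xgetPex; exists unif; exact: uniform_stationary. Qed.

(** Closeness of all rows to one distribution at a single time forces uniqueness, so the choice made
    by [xget] is the uniform one. *)
Lemma stationary_dist_uniform (t delta : R) (q : S -> R) :
  0 <= t -> 0 <= delta -> delta < 1 / 2 -> \sum_x q x = 1 ->
  (forall x, dTV (transition rate t x) q <= delta) -> stationary_dist rate = unif.
Proof.
move=> t0 d0 d1 q1 close.
have [_ s1 s2] := stationary_distP; have [_ u1 u2] := uniform_stationary.
apply: (stationary_unique d0 d1 (fun x => transition_total x t0) q1 close s1 u1).
  by move=> y; exact: s2.
by move=> y; exact: u2.
Qed.

End Stationary.

(** * Consequences of the mixing of two particles *)

Section Pairs.
Variables (R : realType) (G : weighted_graph R) (x0 : G) (h : R) (N : nat).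
Local Notation S := (config G 2).
Hypotheses (h_ge0 : 0 <= h) (h_small : 2 * h * total_weight G <= 1).
Hypothesis G2 : (2 <= #|G|)%N.
Hypothesis mixed : forall (x : S) (A : {set S}),
  ip_mean x0 h N (fun r => (perm_config r x \in A)%:R) - #|A|%:R / #|S|%:R <= 1 / 3.

Let fst_pt (x : S) : G := tnth (val x) ord0.
Let snd_pt (x : S) : G := tnth (val x) ord_max.

Lemma pair_config_uniq (v w : G) : v != w -> uniq [tuple v; w].
Proof. by rewrite /= inE => ->. Qed.

Definition pair_config (v w : G) (vw : v != w) : S := exist _ [tuple v; w] (pair_config_uniq vw).

Lemma fst_ptE s (x : S) : fst_pt (perm_config s x) = s (fst_pt x).
Proof. by rewrite /fst_pt tnth_map. Qed.

Lemma snd_ptE s (x : S) : snd_pt (perm_config s x) = s (snd_pt x).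
Proof. by rewrite /snd_pt tnth_map. Qed.

Lemma pair_pts_inj : injective (fun x : S => (fst_pt x, snd_pt x)).
Proof.
move=> x y [e1 e2]; apply/val_inj/eq_from_tnth => i.
by case: i => [[|[|//]] lti]; [move: e1 | move: e2]; rewrite /fst_pt /snd_pt;
  congr (_ = _); congr tnth; apply/val_inj.
Qed.

(** A second particle is added at any other vertex; the events that the first one ends at [b]
    partition the configurations, so their uniform probabilities sum to 1. *)
Lemma pair_fixed_points : \sum_b ip_mean x0 h N (fun r => (r b == b)%:R) <= 1 + #|G|%:R / 3.
Proof.
pose A b := [set y : S | fst_pt y == b]%SET.
have other (b : G) : exists c, b != c.
  have /card_gt0P[c] : (0 < #|predC1 b|)%N by rewrite cardC1 -subn1 subn_gt0.
  by rewrite inE /= eq_sym; exists c.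
have le_b b : ip_mean x0 h N (fun r => (r b == b)%:R) <= #|A b|%:R / #|S|%:R + 1 / 3.
  have [c bc] := other b; have := mixed (pair_config bc) (A b); rewrite lerBlDl.
  by under [X in ip_mean _ _ _ X <= _ -> _]funext => r do rewrite finset.inE fst_ptE.
apply: le_trans (ler_sum _ (fun b _ => le_b b)) _.
rewrite big_split /= sum_const mul1r lerD2r -mulr_suml.
have -> : \sum_b #|A b|%:R = #|S|%:R :> R.
  rewrite -natr_sum -[in RHS]sum1_card (partition_big fst_pt xpredT) //=.
  congr _%:R; apply: eq_bigr => b _; rewrite -sum1_card; apply: eq_bigl => y.
  by rewrite finset.inE.
have [->|S0] := eqVneq (#|S|%:R : R) 0; first by rewrite mul0r.
by rewrite mulfV.
Qed.

(** The kernel of [N] steps is symmetric, so [square_minorized] bounds that of [N + N] steps from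
    below, and there are at most n^2 pairs. *)
Lemma pair_spread_of_mixed (v w : G) (alpha : G -> G -> R) : v != w ->
  (forall a b, 0 <= alpha a b) ->
  (\sum_a \sum_b (a != b)%:R * alpha a b) / (3 * #|G|%:R ^+ 2)
    <= ip_mean x0 h (N + N) (fun r => alpha (r v) (r w)).
Proof.
move=> vw alpha0.
pose x := pair_config vw; pose g (y : S) := alpha (fst_pt y) (snd_pt y).
have mM M := ip_mean_is_mean x0 h_ge0 h_small M.
pose K M (y z : S) := (step_mx G 2 h ^+ M) (enum_rank y) (enum_rank z).
have KE M y z : K M y z = ip_mean x0 h M (fun r => (perm_config r y == z)%:R).
  rewrite -(step_mx_mean x0 h_ge0 h_small M y (fun u => (u == z)%:R)).
  rewrite (bigD1 z) //= eqxx mulr1 big1 ?addr0 // => u /negbTE ->.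
  by rewrite mulr0.
have KA M y (A : {set S}) : \sum_(z in A) K M y z =
    ip_mean x0 h M (fun r => (perm_config r y \in A)%:R).
  rewrite -(step_mx_mean x0 h_ge0 h_small M y (fun u => (u \in A)%:R)) big_mkcond.
  by apply: eq_bigr => z _; case: (z \in A); rewrite ?mulr1 ?mulr0.
have minor y z : (3 * #|S|%:R)^-1 <= \sum_u K N y u * K N u z.
  apply: square_minorized => [y' z'|y'|y' z'|y' A].
  - by rewrite /K -[in LHS](step_mx_sym x0) mxE.
  - rewrite -(mean_one (mM N)).
    rewrite -(step_mx_mean x0 h_ge0 h_small N y' (fun=> 1)).
    by apply: eq_bigr => u _; rewrite mulr1.
  - by rewrite KE; apply: (mean_ge0 (mM N)).
  - by rewrite KA; exact: mixed.
have -> : ip_mean x0 h (N + N) (fun r => alpha (r v) (r w)) =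
    \sum_y (\sum_u K N x u * K N u y) * g y.
  transitivity (ip_mean x0 h (N + N) (fun r => g (perm_config r x))).
    congr ip_mean; apply/funext => r; by rewrite /g fst_ptE snd_ptE.
  rewrite -step_mx_mean //; apply: eq_bigr => y _; rewrite exprD mxE sum_enum_rank //.
have gsum : \sum_a \sum_b (a != b)%:R * alpha a b <= \sum_y g y.
  rewrite pair_bigA /= (partition_big (fun y : S => (fst_pt y, snd_pt y)) xpredT) //=.
  apply: ler_sum => [[a b]] _ /=.
  have [ab|ab] := eqVneq a b; first by rewrite mul0r; apply: sumr_ge0 => y _; exact: alpha0.
  rewrite mul1r (bigD1 (pair_config ab)) /=; last first.
    by rewrite /fst_pt /snd_pt !(tnth_nth a).
  have -> : g (pair_config ab) = alpha a b by rewrite /g /fst_pt /snd_pt !(tnth_nth a).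
  by rewrite lerDl; apply: sumr_ge0 => y _; exact: alpha0.
have Sn : #|S|%:R <= #|G|%:R ^+ 2 :> R.
  rewrite -natrX ler_nat expnS expn1 -card_prod.
  exact: leq_card pair_pts_inj.
have S1 : 0 < #|S|%:R :> R by rewrite ltr0n; apply/card_gt0P; exists x.
have g0 : 0 <= \sum_y g y by apply: sumr_ge0 => y _; exact: alpha0.
apply: (@le_trans _ _ (\sum_y (3 * #|S|%:R)^-1 * g y)); last first.
  by apply: ler_sum => y _; apply: ler_wpM2r; [exact: alpha0 | exact: minor].
rewrite -mulr_sumr mulrC; apply: ler_pM => //.
- by apply: sumr_ge0 => a _; apply: sumr_ge0 => b _; apply: mulr_ge0.
- have n0 := lt_le_trans S1 Sn.
  by rewrite lef_pV2 ?posrE; [rewrite ler_pM2l | apply: mulr_gt0 | apply: mulr_gt0].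
Qed.

End Pairs.

(** * Back to continuous time and the mixing time *)

Section Mixing.
Variables (R : realType) (G : weighted_graph R) (x0 : G) (k : nat) (t : R).
Hypotheses (t_ge0 : 0 <= t) (G_large : (2 * k.+1 <= #|G|)%N).
Hypothesis pairs_mixed :
  forall x, dTV (transition (@ip_rate R G 2) t x) (stationary_dist (@ip_rate R G 2)) <= 1 / 4.

Let G2 : (2 <= #|G|)%N. Proof. by lia. Qed.

(** The room between 1/4 and 1/3 absorbs the discretization error, uniformly because there are
    finitely many [x] and [A]. *)
Lemma pairs_mixed_discretely : \forall N \near \oo,
  forall (x : config G 2) (A : {set config G 2}),
  ip_mean x0 (t / N.+1%:R) N.+1 (fun r => (perm_config r x \in A)%:R)
    - #|A|%:R / #|config G 2|%:R <= 1 / 3.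
Proof.
have [_ sum1 _] := stationary_distP x0 G2.
have quarter : (0 : R) <= 1 / 4 by lra.
have uniform : stationary_dist (@ip_rate R G 2) = (fun=> #|config G 2|%:R^-1).
  by apply: (stationary_dist_uniform x0 G2 t_ge0 quarter _ sum1 pairs_mixed); lra.
apply: filter_forall => x; apply: filter_forall => A.
have /(dTV_leP _ _ quarter)/(_ A) := pairs_mixed x.
rewrite uniform transition_sum sumr_const -[_ *+ #|A|]mulr_natl => lim_le.
have : evolve t x (fun y => (y \in A)%:R) < #|A|%:R / #|config G 2|%:R + 1 / 3 by lra.
move=> /(cvgr_lt _ (@evolve_cvg1 _ _ x0 2 t x (fun y => (y \in A)%:R) t_ge0)).
by apply: filterS => N /ltW; rewrite lerBlDl.
Qed.

Lemma evolve_oscillation (J : nat) (A : {set config G k.+1}) (x y : config G k.+1) : (0 < J)%N ->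
  evolve ((J * 3)%:R * t) x (fun u => (u \in A)%:R) -
  evolve ((J * 3)%:R * t) y (fun u => (u \in A)%:R) <=
  2 * k.+1%:R * Num.sqrt (2 * #|G|%:R * (215 / 216) ^+ J).
Proof.
move=> J0; have J3 : (0 < J * 3)%N by rewrite muln_gt0 J0.
(* The indicator of [A], extended to all sequences as [ip_mean_oscillation] demands. *)
pose F (s : seq G) : R := [exists u in A, tval (val u) == s]%:R.
have FE z (r : {perm G}) : F (map r (val (val z))) = (perm_config r z \in A)%:R.
  rewrite /F; congr (nat_of_bool _)%:R; apply/existsP/idP => [[u /andP[uA /eqP e]]|h].
    by rewrite (_ : perm_config r z = u) //; apply/val_inj/val_inj; exact: esym e.
  by exists (perm_config r z); rewrite h /=.
have F1 s : `|F s| <= 1 by rewrite /F normr_nat lern1 leq_b1.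
have cz z := @evolve_cvg _ _ x0 k.+1 (J * 3) t z (fun u => (u \in A)%:R) t_ge0 J3.
apply: (cvgr_to_le (cvgB (cz x) (cz y))).
have := small_steps G t_ge0; have := pairs_mixed_discretely.
apply: filterS2 => N mixed [h0 h1] /=.
have osc := @ip_mean_oscillation _ _ x0 _ N.+1 k h0 h1 G_large
   (pair_fixed_points G2 mixed) (pair_spread_of_mixed h0 h1 mixed) F J
   (val (val x)) (val (val y)) F1 (valP x) (valP y).
have {}osc := osc (size_tuple _) (size_tuple _).
have eJ : (J * (N.+1 + N.+1 + N.+1) = J * 3 * N.+1)%N by lia.
apply: le_trans osc; rewrite eJ.
have EE z : (fun r : {perm G} => F (map r (val (val z)))) =
  (fun r => (perm_config r z \in A)%:R) by apply/funext => r; exact: FE.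
by rewrite !EE ler_norm.
Qed.

(** Averaging the oscillation bound over the second starting point [y] replaces its law by the
    uniform distribution. *)
Lemma interchange_mixed (J : nat) (eps : R) : (0 < J)%N -> eps < 1 / 2 ->
  2 * k.+1%:R * Num.sqrt (2 * #|G|%:R * (215 / 216) ^+ J) <= eps ->
  forall x, dTV (transition (@ip_rate R G k.+1) ((J * 3)%:R * t) x)
     (stationary_dist (@ip_rate R G k.+1)) <= eps.
Proof.
move=> J0 eps12 small.
have eps0 : 0 <= eps.
  by apply: le_trans small; rewrite mulr_ge0 ?sqrtr_ge0.
have T0 : 0 <= (J * 3)%:R * t by apply: mulr_ge0.
have kG : (k.+1 <= #|G|)%N by lia.
have S0 : 0 < #|config G k.+1|%:R :> R by rewrite ltr0n config_gt0.
have close x : dTV (transition (@ip_rate R G k.+1) ((J * 3)%:R * t) x)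
    (fun=> #|config G k.+1|%:R^-1) <= eps.
  apply/(dTV_leP _ _ eps0) => A.
  rewrite transition_sum sumr_const -[_ *+ #|A|]mulr_natl.
  pose e y := evolve ((J * 3)%:R * t) y (fun u : config G k.+1 => (u \in A)%:R).
  have : \sum_y (e x - e y) <= \sum_(y : config G k.+1) eps.
    by apply: ler_sum => y _; apply: le_trans small; exact: evolve_oscillation.
  rewrite sumrB !sum_const {2}/e sum_evolve //.
  have -> : \sum_(u : config G k.+1) (u \in A)%:R = #|A|%:R :> R.
    by rewrite -sum1_card natr_sum [RHS]big_mkcond; apply: eq_bigr => u _; case: (u \in A).
  rewrite -/(e x) => h; rewrite lerBlDr -(ler_pM2l S0) mulrDr mulrCA mulfV ?gt_eqF // mulr1.
  by rewrite -lerBlDr.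
move=> x; rewrite (stationary_dist_uniform x0 kG T0 eps0 eps12 _ close) //.
exact: unif_total.
Qed.

End Mixing.

(** As 864 = 4 * 216, the decay is at most (eps/n)^4. Together with [2 * k <= n] this leaves eps
    times the square root of 2 eps^2 / n, which is at most eps. *)
Lemma rounds_suffice (R : realType) (n J k : nat) (eps : R) :
  0 < eps -> eps < 1 / 2 -> (2 <= n)%N -> 2 * k%:R <= n%:R :> R ->
  864 * ln (n%:R / eps) <= J%:R ->
  2 * k%:R * Num.sqrt (2 * n%:R * (215 / 216) ^+ J) <= eps.
Proof.
move=> e0 e12 n2 kn hJ; set m : R := n%:R in kn hJ *.
have m2 : 2 <= m by rewrite (ler_nat _ 2).
have m0 : 0 < m by lra.
apply: (@le_trans _ _ (m * Num.sqrt (2 * m * (215 / 216) ^+ J))).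
  by apply: ler_wpM2r; [exact: sqrtr_ge0 | exact: kn].
have -> : eps = Num.sqrt (eps ^+ 2) by rewrite sqrtr_sqr gtr0_norm.
rewrite -[X in X * _](gtr0_norm m0) -sqrtr_sqr -sqrtrM ?sqr_ge0 //.
apply: ler_wsqrtr.
have decay : (215 / 216) ^+ J <= (eps / m) ^+ 4.
  have q0 : 0 < m / eps by apply: divr_gt0.
  apply: (@le_trans _ _ (expR (J%:R * (- 1 / 216)))).
    rewrite expRM_natl; apply: lerXn2r; rewrite ?nnegrE; [by lra | exact: expR_ge0 | ].
    by have := expR_ge1Dx (- 1 / 216 : R); lra.
  have -> : eps / m = expR (- ln (m / eps)) by rewrite expRN lnK // invf_div.
  rewrite -expRM_natl ler_expR; lra.
have em : 0 <= eps / m by apply: divr_ge0; lra.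
apply: (@le_trans _ _ (m ^+ 2 * (2 * m * (eps / m) ^+ 4))).
  by apply: ler_wpM2l; [exact: sqr_ge0 | apply: ler_wpM2l => //; lra].
have -> : m ^+ 2 * (2 * m * (eps / m) ^+ 4) = eps ^+ 2 * (2 * eps ^+ 2 / m).
  by field; lra.
rewrite -[X in _ <= X]mulr1 ler_wpM2l ?sqr_ge0 // ler_pdivrMr // mul1r.
by nra.
Qed.

Theorem lemma1p2 (R : realType) :
  exists2 K : R, 0 < K &
    forall (G : weighted_graph R) (eps : R) (k : nat),
      connected_graph G ->
      0 < eps -> eps < 1 / 2 ->
      (1 <= k)%N -> k%:R <= #|G|%:R / 2 :> R ->
      (ip_mixing_time G k eps <=
         K%:E * ip_mixing_time G 2 (1 / 4) * (ln (#|G|%:R / eps))%:E)%E.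
Proof.
(* 2598 = 3 * 866: a round lasts [3 * t], and at most [866 * L] rounds are run. *)
exists 2598; first by rewrite ltr0n.
move=> G eps [|k] _ e0 e12 k1 kG; first by [].
have kG2 : 2 * k.+1%:R <= #|G|%:R :> R by lra.
have G_large : (2 * k.+1 <= #|G|)%N by rewrite -(ler_nat R) natrM.
have [x0 _] : exists x0 : G, x0 \in G by apply/card_gt0P; exact: vertex_nonempty.
have n2 : 2 <= #|G|%:R :> R by rewrite (ler_nat _ 2); lia.
set L := ln (#|G|%:R / eps).
(* This lower bound lets [2 * L] absorb the rounding up of [864 * L] to an integer. *)
have L34 : 3 / 4 <= L.
  have q4 : 4 <= #|G|%:R / eps by rewrite ler_pdivlMr //; lra.
  rewrite -(expRK (3 / 4)) ler_ln ?posrE ?expR_gt0 //; last by lra.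
  apply: le_trans q4; have := expR_ge1Dx (- (3 / 4) : R).
  rewrite expRN; have := expR_gt0 (3 / 4 : R); set E := expR _ => E0 h.
  rewrite -(ler_pM2r E0) mulVf ?gt_eqF // in h; lra.
have [J [J0 J1 J2]] : exists J, [/\ (0 < J)%N, 864 * L <= J%:R & J%:R <= 866 * L].
  exists (Num.truncn (864 * L)).+1; split; first exact: ltn0Sn.
    exact/ltW/truncnS_gt.
  have : (Num.truncn (864 * L))%:R <= 864 * L by rewrite truncn_le; lra.
  by rewrite -natr1; lra.
have c0 : 0 < 2598 * L by lra.
rewrite muleAC -EFinM -lee_pdivrMl //.
(* With the constant moved to the other side, each time [t] that mixes two particles can be treated
   separately; an infinite infimum is covered too. *)
apply/ereal_infP => _ [t [t0 mix] <-].
rewrite lee_pdivrMl // -EFinM.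
apply: (@le_trans _ _ ((J * 3)%:R * t)%:E); last first.
  by rewrite lee_fin ler_wpM2r // natrM; lra.
apply: ereal_inf_lbound; exists ((J * 3)%:R * t) => //; split.
  exact: mulr_ge0.
apply: bigmax_le => [|x _]; first by lra.
have pm y : dTV (transition (@ip_rate R G 2) t y) (stationary_dist (@ip_rate R G 2)) <= 1 / 4.
  apply: le_trans mix.
  exact: (le_bigmax _ (fun s => dTV (transition _ t s) _)).
apply: (interchange_mixed x0 t0 G_large pm J0 e12).
have G2 : (2 <= #|G|)%N by rewrite -(ler_nat R).
exact: (rounds_suffice e0 e12 G2 kG2 J1).
Qed.
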